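(* For $\sigma \in [0,2\pi]$, $\mathbf{k} = (k_{1}, \dots, k_{n}) \in \mathbb{N}^{n}$ and $\mathbf{l} = (l_{1},\dots,l_{n}) \in (\mathbb{Z}_{\ge 0})^{n}$ satisfying $k_{u} -1-l_{u} \ge 0$ for all $u \in \{1,\dots,n\}$, we have \[ \mathrm{Ls}_{\mathbf{k}}^{\mathbf{l}}(\sigma) =i^{|\mathbf{l}|+n}(-1)^{|\mathbf{k}|+n}\sum_{\mathbf{p}+\mathbf{q}+\mathbf{r}=\mathbf{k}-\mathbf{1}_{n}-\mathbf{l}}\frac{\left(-i\pi\right)^{|\mathbf{p}|}}{2^{|\mathbf{p}|+|\mathbf{q}|}}\binom{\mathbf{k}-\mathbf{1}_{n}-\mathbf{l}}{\mathbf{p},\mathbf{q},\mathbf{r}}F_{\mathbf{q}+\mathbf{l}}^{\mathbf{r}}(\sigma), \] where $\mathbf{1}_{n}=(\{1\}^{n})$, the sum is over all $\mathbf{p},\mathbf{q},\mathbf{r}\in(\mathbb{Z}_{\ge0})^{n}$ with $\mathbf{p}+\mathbf{q}+\mathbf{r}=\mathbf{k}-\mathbf{1}_{n}-\mathbf{l}$ (componentwise), and \[\binom{\mathbf{k}-\mathbf{1}_{n}-\mathbf{l}}{\mathbf{p},\mathbf{q},\mathbf{r}} = \prod_{u=1}^{n}\frac{(k_{u}-1-l_{u})!}{p_{u}!q_{u}!r_{u}!}.\]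
   Context: Notation: for an index $\mathbf{k}=(k_1,\dots,k_n)$, $|\mathbf{k}|=k_1+\dots+k_n$, $\mathrm{dep}(\mathbf{k})=n$, $\mathbf{k}_{-}=(k_1,\dots,k_{n-1})$; sums/differences of indices are componentwise. $A(\theta)=\log|2\sin(\theta/2)|$ and the iterated log-sine integral is $\mathrm{Ls}_{\mathbf{k}}^{\mathbf{l}}(\sigma)=(-1)^{n}\int_{0<\theta_1<\dots<\theta_n<\sigma}\prod_{u=1}^{n}\theta_u^{l_u}A(\theta_u)^{k_u-1-l_u}\,d\theta_1\cdots d\theta_n$. Multiple polylogarithms: $\mathrm{Li}_{\mathbf{k}}(z)=\sum_{0<m_1<\dots<m_n} z^{m_n}/(m_1^{k_1}\cdots m_n^{k_n})$ (holomorphically continued to $\mathbb{C}\setminus[1,\infty)$), $\mathrm{Li}_{\emptyset}=1$. Definition of $F$: Let $B_{\mathbf{q}}=\frac{1}{|\mathbf{q}|+n}B_{\mathbf{q}_-}$, $B_\emptyset=1$; $C_{\mathbf{q}}^{\mathbf{j}}=(-1)^{j_n}\frac{(|\mathbf{q}|-|\mathbf{j}_-|)!}{(|\mathbf{q}|-|\mathbf{j}|)!}C_{\mathbf{q}_-}^{\mathbf{j}_-}$, $C_\emptyset^\emptyset=1$. Write $\mathbf{j}\preceq\mathbf{q}$ if $j_1+\dots+j_s\le q_1+\dots+q_s$ for all $s$ (and $\emptyset\preceq\emptyset$). Let $\mathfrak{H}=\mathbb{Q}\langle e_0,e_1\rangle$, $\mathfrak{H}^1=\mathbb{Q}+e_1\mathfrak{H}$,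 with the shuffle product $\sqcup\!\sqcup$ defined by $w\sqcup\!\sqcup 1=1\sqcup\!\sqcup w=w$ and $u_1w_1\sqcup\!\sqcup u_2w_2=u_1(w_1\sqcup\!\sqcup u_2w_2)+u_2(u_1w_1\sqcup\!\sqcup w_2)$ ($u_1,u_2\in\{e_0,e_1\}$, words $w_1,w_2$), extended $\mathbb{Q}$-bilinearly. Define $w_{\mathbf{j}}^{\mathbf{r}}=(w_{\mathbf{j}_-}^{\mathbf{r}_-}\sqcup\!\sqcup e_1^{\sqcup\!\sqcup r_n})e_0^{1+j_n}$, $w_\emptyset^\emptyset=1$, where $e_1^{\sqcup\!\sqcup r}$ is the $r$-fold shuffle product of $e_1$ with itself. Define the $\mathbb{Q}$-linear map $L(\cdot;z):\mathfrak{H}^1\to\mathbb{C}$ by $L(e_1e_0^{k_1-1}\cdots e_1e_0^{k_n-1};z)=\mathrm{Li}_{k_1,\dots,k_n}(z)$, $L(1;z)=1$. For $\mathbf{q},\mathbf{r}\in(\mathbb{Z}_{\ge0})^n$ write $\mathbf{r}=(\{0\}^{n'},r''_1,\dots,r''_{n''})=(\mathbf{r}',\mathbf{r}'')$ with $r''_1\ge1$ (so $n'+n''=n$), $\mathbf{q}=(\mathbf{q}',\mathbf{q}'')$ with $\mathbf{q}'$ of length $n'$, and $\overline{\mathbf{q}}=(|\mathbf{q}'|+n'+q''_1,q''_2,\dots,q''_{n''})$ if $\mathbf{q}''\neq\emptyset$, $\overline{\mathbf{q}}=\emptyset$ otherwise. For $\sigma\in[0,2\pi]$ set $f_{\mathbf{q}}^{\mathbf{r}}(\sigma)=B_{\mathbf{q}'}\sum_{\mathbf{j}\preceq\overline{\mathbf{q}}}C_{\overline{\mathbf{q}}}^{\mathbf{j}}(i\sigma)^{|\mathbf{q}|+n'-|\mathbf{j}|}L(w_{\mathbf{j}}^{\mathbf{r}''};e^{i\sigma})$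 (sum over $\mathbf{j}\in(\mathbb{Z}_{\ge0})^{n''}$; so $f=1$ if $\mathbf{r}=\emptyset$ and $f=B_{\mathbf{q}}(i\sigma)^{|\mathbf{q}|+n}$ if $\mathbf{r}=(\{0\}^n)$, $n\ge1$), and $F_{\mathbf{q}}^{\mathbf{r}}(\sigma)=\sum(-1)^{h-1}\Bigl(\prod_{j=1}^{h-1}f_{\mathbf{q}^{(j)}}^{\mathbf{r}^{(j)}}(0)\Bigr)\bigl(f_{\mathbf{q}^{(h)}}^{\mathbf{r}^{(h)}}(\sigma)-f_{\mathbf{q}^{(h)}}^{\mathbf{r}^{(h)}}(0)\bigr)$, the sum over all decompositions $\mathbf{q}=(\mathbf{q}^{(1)},\dots,\mathbf{q}^{(h)})$, $\mathbf{r}=(\mathbf{r}^{(1)},\dots,\mathbf{r}^{(h)})$ into consecutive blocks with $\mathrm{dep}(\mathbf{q}^{(j)})=\mathrm{dep}(\mathbf{r}^{(j)})\ge1$; $F_\emptyset^\emptyset=1$. *)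

(* Defs.v *)
From HB Require Import structures.
From mathcomp Require Import all_boot all_order all_algebra.
From mathcomp Require Import all_classical all_reals all_analysis.
From mathcomp Require Import complex.

Set Implicit Arguments.
Unset Strict Implicit.
Unset Printing Implicit Defensive.

Import Order.TTheory GRing.Theory Num.Theory.
Local Open Scope ring_scope.
Local Open Scope complex_scope.
Local Open Scope classical_set_scope.
Local Open Scope ring_scope.

Section LogSine.
Variable R : realType.

Definition idx_add (a b : seq nat) : seq nat := [seq (x.1 + x.2)%N | x <- zip a b].
Definition idx_km1l (k l : seq nat) : seq nat := [seq (x.1 - 1 - x.2)%N | x <- zip k l].

Fixpoint triples (d : seq nat) : seq (seq nat * seq nat * seq nat) :=
  match d with
  | [::] => [:: ([::], [::], [::])]
  | x :: ds =>
      flatten [seq [seq (pq.1 :: t.1.1, pq.2 :: t.1.2, (x - pq.1 - pq.2)%N :: t.2)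
                   | t <- triples ds]
              | pq <- [seq (p, q) | p <- iota 0 x.+1, q <- iota 0 (x.+1 - p)%N]]
  end.

Fixpoint bseqs (m N : nat) : seq (seq nat) :=
  match m with
  | 0 => [:: [::]]
  | m'.+1 => [seq x :: s | x <- iota 0 N.+1, s <- bseqs m' N]
  end.

Definition prec (j q : seq nat) : bool :=
  (size j == size q)%N &&
  all (fun s => (sumn (take s j) <= sumn (take s q))%N) (iota 1 (size j)).

Fixpoint compsF (fuel m : nat) : seq (seq nat) :=
  match fuel with
  | 0 => [:: [::]]
  | fuel'.+1 =>
      if m == 0 then [:: [::]]
      else flatten [seq [seq i.+1 :: c | c <- compsF fuel' (m - i.+1)%N] | i <- iota 0 m]
  end.
Definition compositions (m : nat) : seq (seq nat) := compsF m m.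

Fixpoint blocks (c : seq nat) (s : seq nat) : seq (seq nat) :=
  match c with
  | [::] => [::]
  | a :: c' => take a s :: blocks c' (drop a s)
  end.

(* Words in e_0, e_1 (true = e_1, false = e_0), formal sums of words   *)
(* with multiplicity, and the shuffle product.                          *)

Definition word := seq bool.

Fixpoint shw (u v : word) : seq word :=
  match u with
  | [::] => [:: v]
  | a :: u' =>
      let fix shv (v : word) : seq word :=
        match v with
        | [::] => [:: u]
        | b :: v' => [seq a :: w | w <- shw u' v] ++ [seq b :: w | w <- shv v']
        end
      in shv v
  end.

Definition shuffle (A B : seq word) : seq word :=
  flatten [seq shw u v | u <- A, v <- B].

Definition e1_shpow (r : nat) : seq word :=
  iter r (shuffle [:: [:: true]]) [:: [::]].

Fixpoint wrev (jr : seq (nat * nat)) : seq word :=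
  match jr with
  | [::] => [:: [::]]
  | x :: rest => [seq w ++ nseq (1 + x.1) false | w <- shuffle (wrev rest) (e1_shpow x.2)]
  end.
Definition w_jr (j r : seq nat) : seq word := wrev (rev (zip j r)).

(* index of a word e_1 e_0^{k_1-1} ... e_1 e_0^{k_n-1} *)
Fixpoint word_aux (w : word) : nat * seq nat :=
  match w with
  | [::] => (0%N, [::])
  | b :: w' => let p := word_aux w' in
               if b then (0%N, p.1.+1 :: p.2) else (p.1.+1, p.2)
  end.
Definition word_index (w : word) : seq nat := (word_aux w).2.

(* harm krev M = sum_{0<m_1<...<m_s<M} 1/(m_1^{k_1}...m_s^{k_s}),
   where krev = (k_s, ..., k_1) *)
Fixpoint harm (krev : seq nat) (M : nat) : R :=
  match krev with
  | [::] => 1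
  | k :: ks => \sum_(1 <= m < M) ((m%:R ^+ k)^-1 * harm ks m)
  end.

(* Li_k(e^{i sigma}) = sum_{0<m_1<...<m_n} e^{i m_n sigma}/(m_1^{k_1}...m_n^{k_n}),
   the series being summed as lim_N sum_{m_n <= N}; real and imaginary
   parts written out separately. *)
Definition Li_circ (k : seq nat) (sigma : R) : R[i] :=
  match rev k with
  | [::] => 1
  | kn :: krest =>
      (lim ((fun N : nat => \sum_(1 <= m < N.+1)
               (cos (m%:R * sigma) * (m%:R ^+ kn)^-1 * harm krest m)) @ \oo))
      +i*
      (lim ((fun N : nat => \sum_(1 <= m < N.+1)
               (sin (m%:R * sigma) * (m%:R ^+ kn)^-1 * harm krest m)) @ \oo))
  end.

Definition Lw (ws : seq word) (sigma : R) : R[i] :=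
  \sum_(w <- ws) Li_circ (word_index w) sigma.

Fixpoint Brec (qr : seq nat) : R[i] :=
  match qr with
  | [::] => 1
  | _ :: qs => ((sumn qr + size qr)%N%:R)^-1 * Brec qs
  end.
Definition Bq (q : seq nat) : R[i] := Brec (rev q).

Fixpoint Crec (qr jr : seq nat) : R[i] :=
  match qr, jr with
  | _ :: qs, j0 :: js =>
      (-1) ^+ j0 * (((sumn qr - sumn js)%N`!)%:R / ((sumn qr - sumn jr)%N`!)%:R)
      * Crec qs js
  | _, _ => 1
  end.
Definition Cqj (q j : seq nat) : R[i] := Crec (rev q) (rev j).

Definition f_qr (q r : seq nat) (sigma : R) : R[i] :=
  let n' := find (fun x => x != 0%N) r in
  let q' := take n' q in
  let q'' := drop n' q in
  let r'' := drop n' r in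
  let qbar := match q'' with
              | [::] => [::]
              | a :: t => (sumn q' + n' + a)%N :: t
              end in
  Bq q' * \sum_(j <- [seq j <- bseqs (size qbar) (sumn qbar) | prec j qbar])
            (Cqj qbar j * ('i * sigma%:C) ^+ (sumn q + n' - sumn j)%N
             * Lw (w_jr j r'') sigma).

Definition F_qr (q r : seq nat) (sigma : R) : R[i] :=
  if size q == 0%N then 1 else
  \sum_(c <- compositions (size q))
    let qs := blocks c q in
    let rs := blocks c r in
    let h := size c in
    (-1) ^+ (h.-1)
    * (\prod_(i < h.-1) f_qr (nth [::] qs i) (nth [::] rs i) 0)
    * (f_qr (nth [::] qs h.-1) (nth [::] rs h.-1) sigma
       - f_qr (nth [::] qs h.-1) (nth [::] rs h.-1) 0).

Definition Afun (theta : R) : R := ln `|2 * sin (theta / 2)|.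

(* Irec ((k_n,l_n) :: ... :: (k_1,l_1)) t
   = int_{0<theta_1<...<theta_n<t} prod_u theta_u^{l_u} A(theta_u)^{k_u-1-l_u},
   written as an iterated (Lebesgue) integral. *)
Fixpoint Irec (klr : seq (nat * nat)) (t : R) : R :=
  match klr with
  | [::] => 1
  | x :: rest =>
      Rintegral (@lebesgue_measure R) `[0, t]%classic
        (fun theta => theta ^+ x.2 * Afun theta ^+ (x.1 - 1 - x.2)%N * Irec rest theta)
  end.

Definition Ls (k l : seq nat) (sigma : R) : R :=
  (-1) ^+ (size k) * Irec (rev (zip k l)) sigma.

Definition multinom3 (d p q r : seq nat) : R[i] :=
  (\prod_(x <- d) (x`!)%:R) /
  ((\prod_(x <- p) (x`!)%:R) * (\prod_(x <- q) (x`!)%:R) * (\prod_(x <- r) (x`!)%:R)).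

End LogSine.
Arguments multinom3 {R}.
Arguments Bq {R}.
Arguments Brec {R}.
Arguments Crec {R}.
Arguments Cqj {R}.

(* Main.v *)
Require Import Defs.
From HB Require Import structures.
From mathcomp Require Import all_boot all_order all_algebra.
From mathcomp Require Import all_classical all_reals all_analysis.
From mathcomp Require Import measurable_realfun complex ring lra zify.
Import Order.TTheory GRing.Theory Num.Theory.
Import numFieldNormedType.Exports.

Set Implicit Arguments.
Unset Strict Implicit.
Unset Printing Implicit Defensive.

Local Open Scope ring_scope.
Local Open Scope complex_scope.
Local Open Scope classical_set_scope.
Local Open Scope ring_scope.

Local Notation Re := complex.Re.
Local Notation Im := complex.Im.

(** On the circle, [Lam x = - A x + i (pi - x) / 2] is the boundary value of
    [Li_1(z) = - log (1 - z)] at [z = e^{ix}].  Expanding the powers of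
    [- A = Lam - i pi / 2 + i x / 2] by the multinomial theorem reduces the claim to
    showing that [F_q^r] is the iterated integral of the forms
    [(i x)^{q_u} Lam(x)^{r_u} d(i x)].  This follows from
    [f_q^r(t) - f_q^r(0) = int_0^t i (i x)^{q_n} Lam(x)^{r_n} f_{q_-}^{r_-}(x) dx],
    the decompositions into blocks in [F] accounting for the constants [f(0)].
    To prove the formula for [f], replace [e^{ix}] by [rho e^{ix}] with [rho < 1].
    There [L(w; z) Li_1(z)^r = L(w sh e_1^r; z)] by comparing coefficients (the
    operator [z d/dz] is a derivation stripping the last letter of a word), and
    termwise integration by parts gives the formula; then let [rho] tend to [1]
    by dominated convergence, the integrands being bounded uniformly in [rho] by a
    power of [1 + |log sin (x / 2)|], which is integrable. *)

(** * Shuffles and power series coefficients *)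

(** On the circle itself the shuffle formula is out of reach: the coefficients of a word of [H^1]
    ending in [e_1] are not summable there. After one integration, however, every word ends in
    [e_0], and summation by parts shows that such series converge absolutely up to the boundary.
    Hence only two kinds of limit in rho occur: Abel's theorem for absolutely convergent series, and
    [Li_1] alone, whose closed form -log(1 - rho e^{ix}) is obtained by comparing derivatives in
    rho, without complex analysis. The factors (-1)^j M!/(M-j)! in [C] are those of repeated
    integration by parts of (ix)^M, and e_0^{1+j} records the j + 1 primitives taken of the other
    factor. Leading zeros of [r] have no series to integrate; they only raise the power of ix,
    whence the factor [B] and the merged first entry of the index. Integrability of powers of the
    logarithm rests on the majorant x^{-1/2} + (2 pi - x)^{-1/2}. *)

Lemma shw_nilr u : shw u [::] = [:: u].
Proof. by case: u. Qed.

Lemma shw_cons a u b v :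
  shw (a :: u) (b :: v) = map (cons a) (shw u (b :: v)) ++ map (cons b) (shw (a :: u) v).
Proof. by []. Qed.

(** The shuffle is defined through first letters, whereas differentiation strips the last one; this
    is the mirrored recursion. Summing an arbitrary [phi] avoids permutations of lists of words. *)
Lemma sum_shw_rcons (V : nmodType) (phi : word -> V) u v a b :
  \sum_(w <- shw (rcons u a) (rcons v b)) phi w =
  \sum_(w <- shw u (rcons v b)) phi (rcons w a) +
  \sum_(w <- shw (rcons u a) v) phi (rcons w b).
Proof.
elim: u v phi => [|c u IHu].
  elim=> [|d v IHv] phi.
    by rewrite /= !big_cons !big_nil !addr0 addrC.
  rewrite !rcons_cons shw_cons big_cat !big_map /=.
  rewrite (IHv (fun w => phi (d :: w))) /= !big_cons !big_nil !big_map !addr0.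
  by rewrite addrCA; congr (_ + _).
elim=> [|d v IHv] phi.
  rewrite !rcons_cons shw_cons big_cat !big_map /=.
  rewrite (IHu [::] (fun w => phi (c :: w))) /= !shw_nilr !big_cons !big_nil.
  rewrite !addr0 big_cat big_map big_seq1 /= -!addrA; congr (_ + _).
  by rewrite addrC.
rewrite !rcons_cons shw_cons big_cat !big_map.
rewrite -!rcons_cons (IHv (fun w => phi (d :: w))).
rewrite (IHu (d :: v) (fun w => phi (c :: w))).
rewrite !rcons_cons [shw (c :: u) (d :: rcons v b)]shw_cons.
rewrite [shw (c :: rcons u a) (d :: v)]shw_cons !big_cat !big_map /=.
by rewrite addrACA.
Qed.

Lemma size_shw u v w : w \in shw u v -> size w = (size u + size v)%N.
Proof.
elim: u v w => [|a u IHu] v w /=; first by rewrite inE => /eqP ->.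
elim: v w => [|b v IHv] w /=; first by rewrite inE => /eqP -> /=; rewrite addn0.
rewrite mem_cat => /orP[] /mapP[w' w'in ->] /=.
  by rewrite (IHu _ _ w'in).
by rewrite (IHv _ w'in) addnS.
Qed.

(* Words of [H^1]: the empty word and the words beginning with [e_1]. *)
Definition adm (w : word) : bool := head true w.

Lemma adm_rcons w b : adm (rcons w b) -> adm w.
Proof. by case: w. Qed.

Lemma adm_rcons_nonnil w : adm (rcons w false) -> w != [::].
Proof. by case: w. Qed.

Lemma adm_cat w v : w != [::] -> adm (w ++ v) = adm w.
Proof. by case: w. Qed.

Lemma adm_shw u v : adm u -> adm v -> all adm (shw u v).
Proof.
case: u => [|a u] ua; first by rewrite /= andbT.
case: v => [|b v] va; first by rewrite /= andbT; exact: ua.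
rewrite shw_cons all_cat !all_map; apply/andP; split; apply/allP => w _ /=.
  exact: ua.
exact: va.
Qed.

Section Coefficients.
Variable R : realType.
Implicit Types (w u v : word) (m N : nat) (a b : nat -> R).

(* Coefficient of [z^m] in [L(w; z)], with [w] read from its last letter. *)
Fixpoint acoef (w : word) (m : nat) : R :=
  match w with
  | [::] => (m == 0)%:R
  | b :: w' => m%:R^-1 * (if b then \sum_(i < m) acoef w' i else acoef w' m)
  end.

Definition wcoef w := acoef (rev w).

Lemma wcoef_nil m : wcoef [::] m = (m == 0)%:R.
Proof. by []. Qed.

Lemma wcoef_rcons w (b : bool) m : wcoef (rcons w b) m =
  m%:R^-1 * (if b then \sum_(i < m) wcoef w i else wcoef w m).
Proof. by rewrite /wcoef rev_rcons. Qed.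

Lemma wcoef_at0 w : w != [::] -> wcoef w 0 = 0.
Proof. by case/lastP: w => // w b _; rewrite wcoef_rcons invr0 mul0r. Qed.

Lemma wcoef_ge0 w m : 0 <= wcoef w m.
Proof.
elim/last_ind: w m => [|w b IH] m; first by rewrite wcoef_nil ler0n.
rewrite wcoef_rcons mulr_ge0 ?invr_ge0 ?ler0n //.
by case: b; rewrite ?sumr_ge0.
Qed.

Lemma wcoef_le1 w m : wcoef w m <= 1.
Proof.
elim/last_ind: w m => [|w b IH] m; first by rewrite wcoef_nil lern1 leq_b1.
rewrite wcoef_rcons; case: m => [|m]; first by rewrite invr0 mul0r.
rewrite ler_pdivrMl ?ltr0n // mulr1; case: b.
  rewrite -[leRHS]/(m.+1%:R) -[X in _ <= X%:R]card_ord -sum1_card natr_sum.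
  by apply: ler_sum.
by rewrite (le_trans (IH _)) // ler1n.
Qed.

(** The delicate case is m = 0, where the left side vanishes: a final [e_0] then needs
    [wcoef w 0 = 0], and admissibility excludes the empty [w], whose coefficient there is 1. *)
Lemma natr_wcoef_rcons w (b : bool) m : adm (rcons w b) ->
  m%:R * wcoef (rcons w b) m = if b then \sum_(i < m) wcoef w i else wcoef w m.
Proof.
move=> wb; rewrite wcoef_rcons; case: m => [|m].
  rewrite mul0r; case: b wb => [_|/adm_rcons_nonnil w0]; first by rewrite big_ord0.
  by rewrite wcoef_at0.
by rewrite mulVKf // pnatr_eq0.
Qed.

Definition cauchy_prod (a b : nat -> R) (m : nat) : R := \sum_(i < m.+1) a i * b (m - i)%N.

Lemma eq_cauchy_prod a a' b b' m : a =1 a' -> b =1 b' -> cauchy_prod a b m = cauchy_prod a' b' m.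
Proof. by move=> aa' bb'; apply: eq_bigr => i _; rewrite aa' bb'. Qed.

Lemma cauchy_prodC a b m : cauchy_prod a b m = cauchy_prod b a m.
Proof.
rewrite /cauchy_prod (reindex_inj rev_ord_inj); apply: eq_bigr => i _ /=.
by rewrite subSS mulrC subKn // -ltnS.
Qed.

Lemma cauchy_prod_delta a m : cauchy_prod (fun i => (i == 0)%:R) a m = a m.
Proof.
rewrite /cauchy_prod big_ord_recl /= subn0 mul1r big1 ?addr0 // => i _.
by rewrite mul0r.
Qed.

(** Strict partial sums of coefficients amount to multiplication by z/(1 - z), which commutes with
    the product of series. *)
Lemma cauchy_prod_sum a b m :
  cauchy_prod (fun i => \sum_(k < i) a k) b m = \sum_(k < m) cauchy_prod a b k.
Proof.
elim: m => [|m IH]; first by rewrite /cauchy_prod big_ord1 !big_ord0 mul0r.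
rewrite big_ord_recr -IH /cauchy_prod big_ord_recl /= big_ord0 mul0r add0r -big_split.
apply: eq_bigr => i _ /=.
by rewrite /bump /= add1n subSS big_ord_recr /= mulrDl.
Qed.

Lemma natr_cauchy_prod a b m :
  m%:R * cauchy_prod a b m = cauchy_prod (fun i => i%:R * a i) b m + cauchy_prod a (fun i => i%:R * b i) m.
Proof.
rewrite /cauchy_prod mulr_sumr -big_split; apply: eq_bigr => i _ /=.
have im : (i <= m)%N by rewrite -ltnS.
have -> : m%:R = i%:R + (m - i)%:R :> R by rewrite -natrD subnKC.
by ring.
Qed.

(* The Euler operator [z d/dz] is a derivation that strips the last letter. *)
Lemma sum_shw_wcoef u v m : adm u -> adm v ->
  \sum_(w <- shw u v) wcoef w m = cauchy_prod (wcoef u) (wcoef v) m.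
Proof.
have [n] := ubnP (size u + size v).
elim: n u v m => // n IH u v m; rewrite ltnS.
case/lastP: u => [|u a] sz ua va; first by rewrite /= big_seq1 cauchy_prod_delta.
case/lastP: v => [|v b] in sz va *.
  by rewrite shw_nilr big_seq1 cauchy_prodC cauchy_prod_delta.
(* The Euler operator forgets the constant coefficient, so it is compared directly: it is 0 on both
   sides because no word involved is empty. *)
case: m => [|m].
  rewrite /cauchy_prod big_ord1 /= wcoef_at0 ?mul0r -?size_eq0 ?size_rcons //.
  rewrite big_seq big1 // => w /size_shw szw; rewrite wcoef_at0 //.
  by rewrite -size_eq0 szw !size_rcons.
apply: (@mulfI _ m.+1%:R); first by rewrite pnatr_eq0.
rewrite natr_cauchy_prod.
rewrite (@eq_cauchy_prod (fun i => i%:R * wcoef (rcons u a) i) _ _ (wcoef (rcons v b)) _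
  (fun i => natr_wcoef_rcons i ua)) //.
rewrite (@eq_cauchy_prod (wcoef (rcons u a)) (wcoef (rcons u a)) _ _ _ (frefl _)
  (fun i => natr_wcoef_rcons i va)).
have hu k : \sum_(w <- shw u (rcons v b)) wcoef w k = cauchy_prod (wcoef u) (wcoef (rcons v b)) k.
  by apply: IH => //; [move: sz; rewrite !size_rcons; lia | exact: adm_rcons ua].
have hv k : \sum_(w <- shw (rcons u a) v) wcoef w k = cauchy_prod (wcoef (rcons u a)) (wcoef v) k.
  by apply: IH => //; [move: sz; rewrite !size_rcons; lia | exact: adm_rcons va].
rewrite sum_shw_rcons mulrDr; congr (_ + _).
  under eq_bigr do rewrite wcoef_rcons.
  rewrite -mulr_sumr mulVKf ?pnatr_eq0 //; case: a ua hv {IH sz} => ua hv.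
    by rewrite cauchy_prod_sum exchange_big; apply: eq_bigr => i _; rewrite -hu.
  by rewrite hu.
under eq_bigr do rewrite wcoef_rcons.
rewrite -mulr_sumr mulVKf ?pnatr_eq0 //; case: b va hu {IH sz} => va hu.
  rewrite cauchy_prodC cauchy_prod_sum exchange_big; apply: eq_bigr => i _.
  by rewrite cauchy_prodC -hv.
by rewrite hv.
Qed.

(** This gives absolute convergence on the circle for every word ending in [e_0]. A last letter
    [e_0] only shrinks the coefficients; a last letter [e_1] leads to the sum of A(m)/m^2, which
    summation by parts reduces to the sum for the shorter word. *)
Lemma sum_wcoef_div_bounded w :
  exists C : R, forall N, \sum_(m < N) m%:R^-1 * wcoef w m <= C.
Proof.
elim/last_ind: w => [|w b [C IH]].
  exists 0 => N; rewrite big1 // => -[[|i] _] _ /=; first by rewrite invr0 mul0r.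
  by rewrite wcoef_nil mulr0.
case: b; last first.
  exists C => N; apply: le_trans (IH N); apply: ler_sum => -[[|m] _] _ /=.
    by rewrite invr0 !mul0r.
  rewrite wcoef_rcons ler_wpM2l ?invr_ge0 ?ler0n //.
  by rewrite ler_piMl ?wcoef_ge0 // invf_le1 ?ler1n ?ltr0n.
pose A m := \sum_(i < m) wcoef w i.
have A0 m : 0 <= A m by apply: sumr_ge0 => i _; exact: wcoef_ge0.
have AS m : A m.+1 = A m + wcoef w m by rewrite /A big_ord_recr.
exists (2 * A 1%N + 2 * C) => -[|N].
  rewrite big_ord0 addr_ge0 // mulr_ge0 //.
  by apply: le_trans (IH 0%N); rewrite big_ord0.
(* Summation by parts, with [1/m^2 <= 2 (1/m - 1/(m+1))]. *)
have key : \sum_(m < N.+1) m%:R^-1 * wcoef (rcons w true) m + 2 * (A N.+1 / N.+1%:R)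
    <= 2 * A 1%N + 2 * \sum_(m < N.+1) m%:R^-1 * wcoef w m.
  elim: N => [|N IHN].
    by rewrite !big_ord1 /= !invr0 !mul0r add0r divr1 mulr0 addr0.
  rewrite big_ord_recr [in leRHS]big_ord_recr /= wcoef_rcons -/(A N.+1) (AS N.+1).
  set S1 := (X in X + _ <= _) in IHN; set S2 := (X in _ <= _ + 2 * X) in IHN.
  rewrite -/S1 -/S2.
  have a0 := A0 N.+1; have c0 := wcoef_ge0 w N.+1.
  set a := A N.+1 in IHN a0 *; set c := wcoef w N.+1 in c0 *.
  have x0 : (0 : R) < N.+1%:R by rewrite ltr0n.
  set x : R := N.+1%:R in IHN x0 *.
  have x1 : 1 <= x by rewrite /x ler1n.
  have -> : N.+2%:R = x + 1 :> R by rewrite /x -natr1.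
  have xi : 0 < x^-1 by rewrite invr_gt0.
  have -> : (a + c) / (x + 1) = a / x - a * (x^-1 * (x + 1)^-1) + c / (x + 1).
    by field; rewrite !gt_eqF //; lra.
  have h1 : x^-1 * (x^-1 * a) <= 2 * (a * (x^-1 * (x + 1)^-1)).
    have -> : x^-1 * (x^-1 * a) = a * x^-1 * x^-1 by ring.
    have -> : 2 * (a * (x^-1 * (x + 1)^-1)) = a * x^-1 * (2 / (x + 1)) by ring.
    rewrite ler_wpM2l ?mulr_ge0 // ?(ltW xi) //.
    by rewrite ler_pdivlMr ?ler_pdivrMl //; lra.
  have h2 : c / (x + 1) <= x^-1 * c.
    by rewrite mulrC ler_wpM2r // lef_pV2 ?posrE //; lra.
  move: IHN h1 h2; move: (a / x) (x^-1 * (x^-1 * a)) (a * (x^-1 / (x + 1)))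
    (c / (x + 1)) (x^-1 * c) S1 S2 (A 1%N) => *; lra.
apply: le_trans (le_trans key _); first by rewrite lerDl !mulr_ge0 ?invr_ge0 ?ler0n.
by rewrite lerD2l ler_pM2l.
Qed.

Lemma sum_wcoef_rcons_false_bounded w :
  exists C : R, forall N, \sum_(m < N) wcoef (rcons w false) m <= C.
Proof.
have [C H] := sum_wcoef_div_bounded w; exists C => N.
by apply: le_trans (H N); apply: ler_sum => i _; rewrite wcoef_rcons.
Qed.

Lemma wcoef_cat_nseq w j m :
  wcoef (w ++ nseq j false) m = (m%:R ^+ j)^-1 * wcoef w m.
Proof.
elim: j => [|j IH]; first by rewrite cats0 expr0 invr1 mul1r.
rewrite -addn1 nseqD catA cats1 wcoef_rcons IH addn1 exprS invfM mulrA.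
by [].
Qed.

Lemma word_aux_rcons_true w :
  word_aux (rcons w true) = ((word_aux w).1, rcons (word_aux w).2 1%N).
Proof. by elim: w => [|b w IH] //=; rewrite IH; case: b. Qed.

(** A new final [e_0] raises the last entry of the index, provided some [e_1] precedes it; otherwise
    it joins the leading [e_0] counted by the first component. *)
Lemma word_aux_rcons_false w (a : nat) s k : word_aux w = (a, rcons s k) ->
  word_aux (rcons w false) = (a, rcons s k.+1).
Proof.
have nil u c : word_aux u = (c, [::]) -> word_aux (rcons u false) = (c.+1, [::]).
  elim: u c => [|[] u IHu] c /=; first by case=> <-.
    by [].
  by case E : (word_aux u) => [c' s'] /= [<- s'0]; rewrite (IHu c') ?E ?s'0.
elim: w a s k => [|b w IH] a s k /=; first by case: s.
case E : (word_aux w) => [c t] /=; case: b => /=; last first.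
  by case=> <- ts; rewrite (IH c s k) ?E ?ts.
case: s => [|x s] [<-].
  by case=> <- t0; rewrite (nil w c) ?E ?t0.
by case=> <- ts /=; rewrite (IH c s k) ?E ?ts.
Qed.

(** Links the coefficients built letter by letter to the nested sums in [Li_circ]: a final [e_0]
    raises the last exponent, a final [e_1] opens a new exponent 1 over a sum of smaller indices. *)
Lemma wcoef_harm w : adm w -> w != [::] ->
  exists ks k, word_index w = rcons ks k /\
    forall m, (0 < m)%N -> wcoef w m = (m%:R ^+ k)^-1 * harm R (rev ks) m.
Proof.
elim/last_ind: w => // w b IH wb _; case: b wb => wb; last first.
  have [ks [k [wk H]]] := IH (adm_rcons wb) (adm_rcons_nonnil wb).
  exists ks, k.+1; split.
    have e : word_aux w = ((word_aux w).1, rcons ks k).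
      by rewrite -wk; exact: surjective_pairing.
    by rewrite /word_index (word_aux_rcons_false e).
  by move=> m m0; rewrite wcoef_rcons H // exprS invfM mulrA.
exists (word_index w), 1%N; split; first by rewrite /word_index word_aux_rcons_true.
move=> m m0; rewrite wcoef_rcons expr1; congr (_ * _).
have [->|w0] := eqVneq w [::].
  rewrite /=; case: m m0 => // m _; rewrite big_ord_recl /= big1 ?addr0 //.
have [ks [k [wk H]]] := IH (adm_rcons wb) w0.
rewrite wk rev_rcons /=; case: m m0 => // m _.
rewrite big_ord_recl /= wcoef_at0 // add0r big_add1 /= big_mkord.
by apply: eq_bigr => i _; rewrite H.
Qed.

End Coefficients.

(** * Integrability of powers of the logarithmic singularity *)

Section LogSingularity.
Variable R : realType.
Notation mu := (@lebesgue_measure R).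

Definition circ : set R := `]0, 2 * pi[%classic.

(* The integrands have logarithmic singularities at [0] and [2 pi]; all of them
   are dominated by a power of [sing]. *)
Definition sing (x : R) : R := 1 + `|ln (sin (x / 2))|.

Lemma circP (x : R) : circ x <-> 0 < x < 2 * pi.
Proof. by rewrite /circ /= in_itv. Qed.

Lemma measurable_circ : measurable circ.
Proof. exact: measurable_itv. Qed.

Lemma sing_ge1 x : 1 <= sing x.
Proof. by rewrite /sing lerDl. Qed.

Lemma sing_exp_ge1 x r : 1 <= sing x ^+ r.
Proof. by rewrite exprn_ege1 // sing_ge1. Qed.

Lemma measurable_half (A : set R) : measurable_fun A (fun x : R => x / 2).
Proof.
apply: (measurable_funS measurableT (@subsetT _ _)).
by apply: continuous_measurable_fun => x; apply: cvgM => //; exact: cvg_cst.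
Qed.

Lemma measurable_sin_half (A : set R) : measurable_fun A (fun x : R => sin (x / 2)).
Proof.
apply: (measurable_funS measurableT (@subsetT _ _)).
apply: (measurableT_comp (f := sin)) => //; last exact: measurable_half.
by apply: continuous_measurable_fun; exact: continuous_sin.
Qed.

Lemma measurable_sing (A : set R) : measurable_fun A sing.
Proof.
apply: measurable_funD; first exact: measurable_cst.
apply: measurableT_comp => //.
by apply: measurableT_comp; [exact: measurable_ln | exact: measurable_sin_half].
Qed.

Lemma sin_half_circ x : circ x -> 0 < sin (x / 2) <= 1.
Proof.
move=> /circP /andP[x0 x2]; rewrite sin_le1 andbT sin_gt0_pi //.
by apply/andP; split; lra.
Qed.

(** The mean value theorem gives sin(x/2) >= (x/2) cos(x/2), so by the double angle formulas sin x
    >= x cos(x/2)^2 = x (1 + cos x)/2 >= x/2. *)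
Lemma sin_ge_half (x : R) : 0 < x -> x <= pi / 2 -> x / 2 <= sin x.
Proof.
move=> x0 xpi; have pi0 := pi_gt0 R.
have [c] := @MVT R sin cos 0 (x / 2) (divr_gt0 x0 (ltr0n R 2))
  (fun y _ => is_derive_sin y) (continuous_subspaceT (@continuous_sin R)).
rewrite in_itv /= sin0 !subr0 => /andP[c0 cx] sx.
have cc : cos (x / 2) <= cos c.
  by rewrite ltW // ltr_cos // in_itv /=; apply/andP; split; lra.
have xx : x = x / 2 *+ 2 by rewrite -mulr_natr; field.
have cx0 : 0 <= cos x by rewrite cos_ge0_pihalf //; apply/andP; split; lra.
have ch0 : 0 <= cos (x / 2) by rewrite cos_ge0_pihalf //; apply/andP; split; lra.
have h : cos x = cos (x / 2) ^+ 2 *+ 2 - 1 by rewrite {1}xx cos_mulr2n.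
have -> : sin x = (cos (x / 2) * sin (x / 2)) *+ 2 by rewrite {1}xx sin_mulr2n.
rewrite sx; move: h; rewrite -[cos (x / 2) ^+ 2 *+ 2]mulr_natr => h.
rewrite -[leRHS]mulr_natr.
have : x / 2 * (cos (x / 2) ^+ 2 * 2) <= cos (x / 2) * (cos c * (x / 2)) * 2.
  have -> : x / 2 * (cos (x / 2) ^+ 2 * 2) = x * cos (x / 2) * cos (x / 2) by field.
  have -> : cos (x / 2) * (cos c * (x / 2)) * 2 = x * cos (x / 2) * cos c.
    by field.
  by apply: ler_wpM2l => //; apply: mulr_ge0 => //; exact: ltW.
move=> hh; apply: le_trans hh; rewrite -[leLHS]mulr1 ler_pM2l ?divr_gt0 //.
by lra.
Qed.

(** An integrable function that beats every power of the logarithm at both endpoints; the exponent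
    1/2 is chosen for its elementary primitive. *)
Definition invsqrts (x : R) : R := (Num.sqrt x)^-1 + (Num.sqrt (2 * pi - x))^-1.

(** With s = sin(x/2) and y = - ln s, (1 + y)^r <= 2^r r! exp((1 + y)/2) and exp(y/2) = s^{-1/2}.
    Since s is at least a quarter of the distance to the nearer endpoint, s^{-1/2} costs one more
    factor 2. *)
Lemma sing_exp_le r : exists2 C : R, 0 <= C &
  forall x, circ x -> sing x ^+ r <= C * invsqrts x.
Proof.
exists (2 ^+ r * r`!%:R * expR (1 / 2) * 2) => [|x cx].
  by rewrite !mulr_ge0 ?exprn_ge0 ?expR_ge0.
have /andP[s0 s1] := sin_half_circ cx; have /circP /andP[x0 x2] := cx.
have pi0 := pi_gt0 R.
rewrite /sing ler0_norm ?ln_le0 //; set s := sin _ in s0 s1 *.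
set y := - ln s; have y0 : 0 <= y by rewrite /y oppr_ge0 ln_le0.
have hp : ((1 + y) / 2) ^+ r <= r`!%:R * expR ((1 + y) / 2).
  case: r => [|n]; first by rewrite expr0 mul1r -[leLHS]expR0 ler_expR; lra.
  have z0 : 0 <= (1 + y) / 2 by lra.
  rewrite -ler_pdivrMl ?ltr0n ?fact_gt0 // [leLHS]mulrC.
  by apply: le_trans (expR_ge1Dxn n z0); rewrite lerDr.
have hs : expR (y / 2) = (Num.sqrt s)^-1.
  rewrite -[s]lnK ?posrE // -[ln s]opprK -/y.
  have -> : - y = - (y / 2) + - (y / 2) by field.
  by rewrite expRD -expr2 sqrtr_sqr ger0_norm ?expR_ge0 // expRN invrK.
have sb : (Num.sqrt s)^-1 <= 2 * invsqrts x.
  have aux z : 0 < z -> z / 4 <= s -> (Num.sqrt s)^-1 <= 2 * (Num.sqrt z)^-1.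
    move=> z0 zs.
    have -> : 2 * (Num.sqrt z)^-1 = (Num.sqrt (z / 4))^-1.
      rewrite sqrtrM ?ltW // sqrtrV //.
      have -> : (4 : R) = 2 ^+ 2 by ring.
      by rewrite sqrtr_sqr ger0_norm // invfM invrK mulrC.
    by rewrite lef_pV2 ?posrE ?sqrtr_gt0 ?ler_sqrt //; lra.
  have inv0 z : 0 <= (Num.sqrt z : R)^-1 by rewrite invr_ge0 sqrtr_ge0.
  have [xp|xp] := lerP (x / 2) (pi / 2).
    have /aux : x / 4 <= s.
      by have := @sin_ge_half (x / 2) _ xp; rewrite -/s => h; apply: le_trans (h _); lra.
    move=> h; apply: le_trans (h x0) _; rewrite /invsqrts mulrDr lerDl.
    by rewrite mulr_ge0.
  have /aux : (2 * pi - x) / 4 <= s.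
    have := @sin_ge_half (pi - x / 2); rewrite sinB sinpi cospi mul0r sub0r mulN1r opprK -/s.
    by move=> h; apply: le_trans (h _ _); lra.
  have z0 : 0 < 2 * pi - x by lra.
  move=> h; apply: le_trans (h z0) _; apply: ler_wpM2l => //; rewrite /invsqrts lerDr.
  exact: inv0.
have -> : (1 + y) ^+ r = 2 ^+ r * ((1 + y) / 2) ^+ r.
  by rewrite -exprMn; congr (_ ^+ _); field.
rewrite -!mulrA ler_pM2l ?exprn_gt0 //; apply: le_trans hp _.
rewrite ler_pM2l ?ltr0n ?fact_gt0 //.
have -> : (1 + y) / 2 = 1 / 2 + y / 2 by field.
by rewrite expRD ler_pM2l ?expR_gt0 // hs.
Qed.

(** The shift by [e] makes the integrand continuous on the closed interval, so the fundamental
    theorem bounds its integral uniformly in [e]; monotone convergence then removes the shift. *)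
Let invsqrts_eps (e x : R) : R := (Num.sqrt (x + e))^-1 + (Num.sqrt (2 * pi - x + e))^-1.


Let sqrt_eps_derive (e x : R) : 0 < x + e ->
  is_derive x 1 (fun y => 2 * Num.sqrt (y + e)) (Num.sqrt (x + e))^-1.
Proof.
move=> xe; have h1 : is_derive x 1 (fun y : R => y + e) 1.
  by apply: is_derive_eq; rewrite addr0.
have h := @is_derive1_comp _ (@Num.sqrt R) (fun y => y + e) x _ _ (is_derive1_sqrt xe) h1.
have h2 := @is_deriveZ _ _ _ _ 2 _ _ _ h.
apply: (is_derive_eq (f := fun y => 2 * Num.sqrt (y + e))).
rewrite /GRing.scale /= mulr1 invfM mulrA divff ?mul1r //.
Qed.

Let sqrt_eps_deriveN (e x : R) : 0 < 2 * pi - x + e ->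
  is_derive x 1 (fun y => 2 * Num.sqrt (2 * pi - y + e)) (- (Num.sqrt (2 * pi - x + e))^-1).
Proof.
move=> xe; have h1 : is_derive x 1 (fun y : R => 2 * pi - y) (-1).
  have := @is_deriveB _ _ _ (cst (2 * pi)) id x 1 0 1 (is_derive_cst _ _ _) (is_derive_id _ _).
  by rewrite sub0r.
have := @is_derive1_comp _ (fun y => 2 * Num.sqrt (y + e)) (fun y => 2 * pi - y) x _ _
  (sqrt_eps_derive xe) h1.
by rewrite mulrN1.
Qed.

Let invsqrts_eps_continuous (e x : R) : 0 < e -> 0 <= x <= 2 * pi ->
  {for x, continuous (invsqrts_eps e)}.
Proof.
move=> e0 /andP[x0 x2]; apply: cvgD; apply: cvgV.
- by rewrite gt_eqF // sqrtr_gt0; lra.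
- apply: (@continuous_comp _ _ _ (fun y => y + e) Num.sqrt); last exact: sqrt_continuous.
  by apply: cvgD => //; exact: cvg_cst.
- by rewrite gt_eqF // sqrtr_gt0; lra.
- apply: (@continuous_comp _ _ _ (fun y => 2 * pi - y + e) Num.sqrt); last exact: sqrt_continuous.
  apply: cvgD; last exact: cvg_cst.
  by apply: cvgB => //; exact: cvg_cst.
Qed.

Let integral_invsqrts_eps (e : R) : 0 < e <= 1 ->
  (\int[mu]_(x in circ) (invsqrts_eps e x)%:E <= (4 * Num.sqrt (2 * pi + 1))%:E)%E.
Proof.
move=> /andP[e0 e1]; have pi0 := pi_gt0 R.
pose F x : R := 2 * Num.sqrt (x + e) - 2 * Num.sqrt (2 * pi - x + e).
have dF x : 0 <= x <= 2 * pi -> is_derive x 1 F (invsqrts_eps e x).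
  move=> /andP[x0 x2]; have xe : 0 < x + e by lra.
  have xe' : 0 < 2 * pi - x + e by lra.
  have := @is_deriveB _ _ _ _ _ _ _ _ _ (sqrt_eps_derive xe) (sqrt_eps_deriveN xe').
  by rewrite opprK.
have cF x : 0 <= x <= 2 * pi -> {for x, continuous F}.
  move=> h; have [dFx _] := dF x h.
  by apply: differentiable_continuous; apply/derivable1_diffP.
have cf x (h : 0 <= x <= 2 * pi) := invsqrts_eps_continuous e0 h.
have ab : (0 : R) < 2 * pi by lra.
have mf (A : set R) : A `<=` `[0, 2 * pi] -> measurable A -> measurable_fun A (fun x => (invsqrts_eps e x)%:E).
  move=> Asub mA; apply/measurable_EFinP; apply: (measurable_funS _ Asub) => //.
  apply: subspace_continuous_measurable_fun => //; apply: continuous_in_subspaceT => x.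
  by rewrite inE /= in_itv /= => h; exact: cf.
rewrite /circ integral_itv_obnd_cbnd; last first.
  by apply: mf => //; apply: subset_itv_oo_cc.
rewrite integral_itv_bndo_bndc; last first.
  by apply: mf => //; apply: subset_itv_co_cc.
rewrite (@continuous_FTC2 _ _ F) //.
- rewrite -EFinB lee_fin /F subrr add0r subr0.
  have : 0 <= Num.sqrt e by exact: sqrtr_ge0.
  have : Num.sqrt (2 * pi + e) <= Num.sqrt (2 * pi + 1) by rewrite ler_sqrt //; lra.
  by lra.
- by apply: continuous_in_subspaceT => x; rewrite inE /= in_itv /= => h; exact: cf.
- split.
  + by move=> x; rewrite in_itv /= => /andP[x0 x2]; have [] // : is_derive x 1 F _ := dF x _;
      apply/andP; split; lra.
  + by apply: cvg_at_right_filter; apply: cF; rewrite lexx ltW.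
  + by apply: cvg_at_left_filter; apply: cF; rewrite lexx ltW.
- move=> x; rewrite in_itv /= => /andP[x0 x2]; rewrite derive1E.
  by apply: derive_val; apply: dF; rewrite !ltW.
Qed.

Lemma integrable_invsqrts : mu.-integrable circ (EFin \o invsqrts).
Proof.
have mg e : 0 < e -> measurable_fun circ (fun x => (invsqrts_eps e x)%:E).
  move=> e0; apply/measurable_EFinP; apply: open_continuous_measurable_fun.
    exact: interval_open.
  move=> x; rewrite inE => /circP /andP[x0 x2].
  by apply: invsqrts_eps_continuous => //; rewrite !ltW.
pose e n : R := n.+1%:R^-1.
have e0 n : 0 < e n by rewrite invr_gt0 ltr0n.
have cvge x : circ x -> (invsqrts_eps (e n) x)%:E @[n --> \oo] --> (invsqrts x)%:E.
  move=> /circP /andP[x0 x2]; apply/cvg_EFin; first by near=> n.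
  have aux y : 0 < y -> (Num.sqrt (y + e n))^-1 @[n --> \oo] --> (Num.sqrt y)^-1.
    move=> y0; apply: cvgV; first by rewrite gt_eqF // sqrtr_gt0.
    apply: (@cvg_comp _ _ _ (fun n => y + e n) Num.sqrt _ (nbhs y)); last exact: sqrt_continuous.
    have : y + e n @[n --> \oo] --> y + 0 by apply: cvgD; [exact: cvg_cst | exact: cvg_harmonic].
    by rewrite addr0.
  by apply: cvgD; apply: aux; lra.
have g0 n x : circ x -> (0 <= (invsqrts_eps (e n) x)%:E)%E.
  by move=> _; rewrite lee_fin addr_ge0 // invr_ge0 sqrtr_ge0.
have ndg x : circ x -> {homo (fun n => (invsqrts_eps (e n) x)%:E) : n m / (n <= m)%N >-> (n <= m)%E}.
  move=> /circP /andP[x0 x2] n m nm; rewrite lee_fin.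
  have en : e m <= e n by rewrite /e lef_pV2 ?posrE ?ltr0n // ler_nat ltnS.
  have := e0 m; have := e0 n => en0 em0.
  by apply: lerD; rewrite lef_pV2 ?posrE ?sqrtr_gt0 ?ler_sqrt //; lra.
have mc := @cvg_monotone_convergence _ _ _ mu _ measurable_circ _ (fun n => mg (e n) (e0 n)) g0 ndg.
apply/integrableP; split.
  apply: (emeasurable_fun_cvg (fun n x => (invsqrts_eps (e n) x)%:E)) => [n|x cx].
    exact: mg.
  exact: cvge.
apply: (@le_lt_trans _ _ (4 * Num.sqrt (2 * pi + 1))%:E); last by rewrite ltry.
rewrite (_ : integral _ _ _ = (\int[mu]_(x in circ) limn (fun n => (invsqrts_eps (e n) x)%:E))%E).
  move/cvg_lim : (mc) => <- //; apply: lime_le.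
    by apply/cvg_ex; eexists; exact: mc.
  apply: nearW => n; apply: integral_invsqrts_eps; rewrite e0 /=.
  by rewrite /e invf_le1 ?ltr0n // ler1n.
apply: eq_integral => x; rewrite inE => cx.
rewrite gee0_abs; last by rewrite lee_fin addr_ge0 // invr_ge0 sqrtr_ge0.
by rewrite (cvg_lim _ (cvge x cx)).
Unshelve. all: by end_near. Qed.

Lemma integrable_sing_exp (r : nat) : mu.-integrable circ (fun x => (sing x ^+ r)%:E).
Proof.
have [C C0 H] := sing_exp_le r.
have mc := measurable_circ.
apply: (@le_integrable _ _ _ mu circ mc _ (fun x => (C%:E * (invsqrts x)%:E)%E)).
- by apply/measurable_EFinP; apply: measurable_funX; exact: measurable_sing.
- move=> x cx; rewrite -EFinM !abse_EFin lee_fin.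
  rewrite ger0_norm ?exprn_ge0 ?(le_trans ler01 (sing_ge1 x)) //.
  by apply: le_trans (H x cx) _; exact: ler_norm.
- by apply: integrableZl => //; exact: integrable_invsqrts.
Qed.

End LogSingularity.

(** * Complex-valued limits, derivatives and integrals *)

Section ComplexCalculus.
Variable R : realType.
Notation mu := (@lebesgue_measure R).
Notation C := R[i].
Notation circ := (@circ R).
Implicit Types (z : C) (u v : nat -> C) (g h : R -> C).

Lemma cReD z z' : Re (z + z') = Re z + Re z'.
Proof. by case: z z' => ? ? [? ?]. Qed.
Lemma cImD z z' : Im (z + z') = Im z + Im z'.
Proof. by case: z z' => ? ? [? ?]. Qed.
Lemma cReM z z' : Re (z * z') = Re z * Re z' - Im z * Im z'.
Proof. by case: z z' => ? ? [? ?]. Qed.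
Lemma cImM z z' : Im (z * z') = Re z * Im z' + Im z * Re z'.
Proof. by case: z z' => ? ? [? ?]. Qed.
Lemma cReN z : Re (- z) = - Re z. Proof. by case: z. Qed.
Lemma cImN z : Im (- z) = - Im z. Proof. by case: z. Qed.
Lemma complex_eq z z' : Re z = Re z' -> Im z = Im z' -> z = z'.
Proof. by case: z z' => ? ? [? ?] /= -> ->. Qed.

(** The l^1 norm in place of the modulus: it is submultiplicative, bounds both components, and
    involves no square root. *)
Definition cnorm1 z : R := `|Re z| + `|Im z|.

Lemma cnorm1_ge0 z : 0 <= cnorm1 z.
Proof. by rewrite addr_ge0. Qed.
Lemma cnorm10 : cnorm1 0 = 0.
Proof. by rewrite /cnorm1 /= normr0 addr0. Qed.
Lemma cnorm1D z z' : cnorm1 (z + z') <= cnorm1 z + cnorm1 z'.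
Proof. by rewrite /cnorm1 cReD cImD addrACA lerD // ler_normD. Qed.
Lemma cnorm1N z : cnorm1 (- z) = cnorm1 z.
Proof. by rewrite /cnorm1 cReN cImN !normrN. Qed.
Lemma cnorm1M z z' : cnorm1 (z * z') <= cnorm1 z * cnorm1 z'.
Proof.
rewrite /cnorm1 cReM cImM.
have h1 := ler_normB (Re z * Re z') (Im z * Im z').
have h2 := ler_normD (Re z * Im z') (Im z * Re z').
rewrite !normrM in h1 h2; apply: le_trans (lerD h1 h2) _.
by rewrite le_eqVlt; apply/orP; left; apply/eqP; ring.
Qed.
Lemma cnorm1_real (x : R) : cnorm1 x%:C = `|x|.
Proof. by rewrite /cnorm1 /= normr0 addr0. Qed.
Lemma cnorm1_sum (I : Type) (s : seq I) (F : I -> C) :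
  cnorm1 (\sum_(i <- s) F i) <= \sum_(i <- s) cnorm1 (F i).
Proof.
elim/big_ind2: _ => [|x1 x2 y1 y2 h1 h2|//]; first by rewrite cnorm10.
by apply: le_trans (cnorm1D _ _) _; exact: lerD.
Qed.
Lemma norm_Re_le z : `|Re z| <= cnorm1 z. Proof. by rewrite /cnorm1 lerDl. Qed.
Lemma norm_Im_le z : `|Im z| <= cnorm1 z. Proof. by rewrite /cnorm1 lerDr. Qed.

Definition cvgc u z :=
  (Re (u n) @[n --> \oo] --> Re z) /\ (Im (u n) @[n --> \oo] --> Im z).

Lemma cvgc_cst z : cvgc (fun=> z) z.
Proof. by split; exact: cvg_cst. Qed.

Lemma cvgcD u v z z' : cvgc u z -> cvgc v z' -> cvgc (fun n => u n + v n) (z + z').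
Proof.
move=> [u1 u2] [v1 v2]; split; rewrite ?cReD ?cImD.
  by under eq_fun do rewrite cReD; exact: cvgD.
by under eq_fun do rewrite cImD; exact: cvgD.
Qed.

Lemma cvgcM u v z z' : cvgc u z -> cvgc v z' -> cvgc (fun n => u n * v n) (z * z').
Proof.
move=> [u1 u2] [v1 v2]; split; rewrite ?cReM ?cImM.
  by under eq_fun do rewrite cReM; apply: cvgB; exact: cvgM.
by under eq_fun do rewrite cImM; apply: cvgD; exact: cvgM.
Qed.

Lemma cvgcN u z : cvgc u z -> cvgc (fun n => - u n) (- z).
Proof.
move=> /(cvgcM (cvgc_cst (-1))); rewrite mulN1r.
by under eq_fun do rewrite mulN1r.
Qed.

Lemma cvgcX u z k : cvgc u z -> cvgc (fun n => u n ^+ k) (z ^+ k).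
Proof.
move=> uz; elim: k => [|k IH]; first exact: cvgc_cst.
by rewrite exprS; under eq_fun do rewrite exprS; exact: cvgcM.
Qed.

Lemma cvgc_sum (I : Type) (s : seq I) (F : nat -> I -> C) (G : I -> C) :
  (forall i, cvgc (F^~ i) (G i)) ->
  cvgc (fun n => \sum_(i <- s) F n i) (\sum_(i <- s) G i).
Proof.
move=> FG; elim: s => [|i s IH].
  by rewrite big_nil; under eq_fun do rewrite big_nil; exact: cvgc_cst.
by rewrite big_cons; under eq_fun do rewrite big_cons; exact: cvgcD.
Qed.

Lemma cvgc_unique u z z' : cvgc u z -> cvgc u z' -> z = z'.
Proof.
move=> [u1 u2] [v1 v2]; apply: complex_eq.
  exact: (cvg_unique _ u1 v1).
exact: (cvg_unique _ u2 v2).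
Qed.

Lemma cvgc_shift u z : cvgc u z -> cvgc (fun n => u n.+1) z.
Proof.
by move=> [u1 u2]; split; [rewrite -cvg_shiftS in u1 | rewrite -cvg_shiftS in u2].
Qed.

Lemma cvgc_cnorm1 u z (e : nat -> R) : (forall n, cnorm1 (u n - z) <= e n) ->
  e n @[n --> \oo] --> 0 -> cvgc u z.
Proof.
move=> ue e0; have eN0 : - e n @[n --> \oo] --> 0 by rewrite -oppr0; exact: cvgN.
split; apply/subr_cvg0.
- apply: (squeeze_cvgr _ eN0 e0); apply: nearW => n; rewrite -ler_norml.
  by apply: le_trans (ue n); rewrite -cReN -cReD norm_Re_le.
- apply: (squeeze_cvgr _ eN0 e0); apply: nearW => n; rewrite -ler_norml.
  by apply: le_trans (ue n); rewrite -cImN -cImD norm_Im_le.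
Qed.

Lemma cvgc_cnorm1_le u z (e : R) : (forall n, cnorm1 (u n) <= e) -> cvgc u z -> cnorm1 z <= e.
Proof.
move=> ue [u1 u2]; have h : cnorm1 (u n) @[n --> \oo] --> cnorm1 z.
  by apply: cvgD; exact: cvg_norm.
rewrite -(cvg_lim (@Rhausdorff R) h); apply: limr_le; first exact: cvgP h.
exact: nearW.
Qed.

(* Complex functions with logarithmic singularities at most. *)
Definition lgr (K : R) (r : nat) g := [/\ measurable_fun circ (fun x => Re (g x)),
  measurable_fun circ (fun x => Im (g x)) &
  forall x, circ x -> cnorm1 (g x) <= K * sing x ^+ r].

(** [lgr] displays its constants because dominated convergence needs one pair for a whole sequence.
    [lg] hides them; it is closed under sums and products, which makes all integrability checks
    mechanical. *)
Definition lg g := exists K r, 0 <= K /\ lgr K r g.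

Lemma lgrM K r g K' r' h : 0 <= K -> 0 <= K' -> lgr K r g -> lgr K' r' h ->
  lgr (K * K') (r + r') (fun x => g x * h x).
Proof.
move=> K0 K'0 [g1 g2 g3] [h1 h2 h3]; split.
- by under eq_fun do rewrite cReM; apply: measurable_funB; exact: measurable_funM.
- by under eq_fun do rewrite cImM; apply: measurable_funD; exact: measurable_funM.
- move=> x cx; apply: le_trans (cnorm1M _ _) _; rewrite exprD mulrACA.
  by rewrite ler_pM ?cnorm1_ge0 ?g3 ?h3.
Qed.

Lemma lgM g h : lg g -> lg h -> lg (fun x => g x * h x).
Proof.
move=> [K [r [K0 gl]]] [K' [r' [K'0 hl]]]; exists (K * K'), (r + r')%N; split.
  exact: mulr_ge0.
exact: lgrM.
Qed.

Lemma lgrD K r g K' r' h : 0 <= K -> 0 <= K' -> lgr K r g -> lgr K' r' h ->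
  lgr (K + K') (r + r') (fun x => g x + h x).
Proof.
move=> K0 K'0 [g1 g2 g3] [h1 h2 h3]; split.
- by under eq_fun do rewrite cReD; exact: measurable_funD.
- by under eq_fun do rewrite cImD; exact: measurable_funD.
- move=> x cx; apply: le_trans (cnorm1D _ _) _; rewrite mulrDl.
  apply: lerD.
    apply: le_trans (g3 x cx) _; rewrite ler_wpM2l // exprD ler_peMr ?sing_exp_ge1 //.
    exact: le_trans ler01 (sing_exp_ge1 _ _).
  apply: le_trans (h3 x cx) _; rewrite ler_wpM2l // exprD ler_peMl ?sing_exp_ge1 //.
  exact: le_trans ler01 (sing_exp_ge1 _ _).
Qed.

Lemma lgD g h : lg g -> lg h -> lg (fun x => g x + h x).
Proof.
move=> [K [r [K0 gl]]] [K' [r' [K'0 hl]]]; exists (K + K'), (r + r')%N; split.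
  exact: addr_ge0.
exact: lgrD.
Qed.

Lemma lgr_cst z : lgr (cnorm1 z) 0 (fun=> z).
Proof.
split; first exact: measurable_cst.
  exact: measurable_cst.
by move=> x _; rewrite expr0 mulr1.
Qed.

Lemma lg_cst z : lg (fun=> z).
Proof. by exists (cnorm1 z), 0%N; split; [exact: cnorm1_ge0 | exact: lgr_cst]. Qed.

Lemma lgX g k : lg g -> lg (fun x => g x ^+ k).
Proof.
move=> gl; elim: k => [|k IH]; first exact: lg_cst.
by under eq_fun do rewrite exprS; exact: lgM.
Qed.

Lemma lg_sum (I : eqType) (s : seq I) (F : I -> R -> C) :
  (forall i, i \in s -> lg (F i)) -> lg (fun x => \sum_(i <- s) F i x).
Proof.
elim: s => [|i s IH] Fl.
  by under eq_fun do rewrite big_nil; exact: lg_cst.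
under eq_fun do rewrite big_cons.
apply: lgD; first by apply: Fl; rewrite mem_head.
by apply: IH => k ks; apply: Fl; rewrite inE ks orbT.
Qed.

Lemma eq_lg g h : (forall x, circ x -> g x = h x) -> lg g -> lg h.
Proof.
move=> gh [K [r [K0 [g1 g2 g3]]]]; exists K, r; split => //; split.
- apply: eq_measurable_fun g1 => x; rewrite inE => cx /=; by rewrite gh.
- apply: eq_measurable_fun g2 => x; rewrite inE => cx /=; by rewrite gh.
- by move=> x cx; rewrite -gh //; exact: g3.
Qed.

Lemma lg_real (f : R -> R) (K : R) r : 0 <= K -> measurable_fun circ f ->
  (forall x, circ x -> `|f x| <= K * sing x ^+ r) -> lg (fun x => (f x)%:C).
Proof.
move=> K0 mf fK; exists K, r; split=> //; split => //=.
by move=> x cx; rewrite cnorm1_real; exact: fK.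
Qed.

Lemma lg_id : lg (fun x => x%:C).
Proof.
have pi0 := pi_gt0 R.
apply: (@lg_real _ (2 * pi) 0); [lra | exact: measurable_id |].
move=> x /circP /andP[x0 x2]; rewrite expr0 mulr1 ger0_norm; lra.
Qed.

Section Interval.
Variable t : R.
Hypothesis t2 : t <= 2 * pi.

Lemma subset_circ : `]0, t[%classic `<=` circ.
Proof.
move=> x /=; rewrite in_itv /= => /andP[x0 xt]; apply/circP; rewrite x0.
exact: lt_le_trans t2.
Qed.

Let mt : measurable `]0, t[%classic := measurable_itv _.

Lemma integrable_sing_t K r : mu.-integrable `]0, t[ (fun x => (K * sing x ^+ r)%:E).
Proof.
apply: (@integrableS _ _ R mu circ _ _ (@measurable_circ R) mt subset_circ).
have h : mu.-integrable circ (fun x => (K%:E * (sing x ^+ r)%:E)%E).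
  by apply: integrableZl; [exact: measurable_circ | exact: integrable_sing_exp].
exact: h.
Qed.

Lemma lgr_integrable K r g : lgr K r g ->
  mu.-integrable `]0, t[ (EFin \o (fun x => Re (g x))) /\
  mu.-integrable `]0, t[ (EFin \o (fun x => Im (g x))).
Proof.
move=> [g1 g2 g3]; split.
- apply: (@le_integrable _ _ R mu _ mt _ _ _ _ (integrable_sing_t K r)).
    by apply/measurable_EFinP; apply: (measurable_funS (@measurable_circ R) subset_circ).
  move=> x /subset_circ cx /=; rewrite lee_fin; apply: le_trans (norm_Re_le _) _.
  exact: le_trans (g3 x cx) (ler_norm _).
- apply: (@le_integrable _ _ R mu _ mt _ _ _ _ (integrable_sing_t K r)).
    by apply/measurable_EFinP; apply: (measurable_funS (@measurable_circ R) subset_circ).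
  move=> x /subset_circ cx /=; rewrite lee_fin; apply: le_trans (norm_Im_le _) _.
  exact: le_trans (g3 x cx) (ler_norm _).
Qed.

Lemma lg_integrable g : lg g ->
  mu.-integrable `]0, t[ (EFin \o (fun x => Re (g x))) /\
  mu.-integrable `]0, t[ (EFin \o (fun x => Im (g x))).
Proof. by move=> [K [r [_ /lgr_integrable]]]. Qed.

(** The open interval lies inside [circ] when t <= 2 pi, so bounds away from the singular endpoints
    suffice. *)
Definition cint g : C :=
  (\int[mu]_(x in `]0, t[) Re (g x))%R +i* (\int[mu]_(x in `]0, t[) Im (g x))%R.

Lemma eq_cint g h : (forall x, circ x -> g x = h x) -> cint g = cint h.
Proof.
move=> gh; congr (_ +i* _); apply: eq_Rintegral => x; rewrite inE => /subset_circ cx;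
  by rewrite gh.
Qed.

Lemma cintD g h : lg g -> lg h -> cint (fun x => g x + h x) = cint g + cint h.
Proof.
move=> /lg_integrable[g1 g2] /lg_integrable[h1 h2]; apply: complex_eq; rewrite ?cReD ?cImD /=.
  by under eq_Rintegral do rewrite cReD; exact: RintegralD.
by under eq_Rintegral do rewrite cImD; exact: RintegralD.
Qed.

Lemma cintZ z g : lg g -> cint (fun x => z * g x) = z * cint g.
Proof.
move=> /lg_integrable[g1 g2].
have iZ (a : R) (f : R -> R) : mu.-integrable `]0, t[ (EFin \o f) ->
    mu.-integrable `]0, t[ (EFin \o (fun x => a * f x)).
  move=> fi; have h : mu.-integrable `]0, t[ (fun x => (a%:E * (EFin \o f) x)%E).
    by apply: integrableZl.
  exact: h.
apply: complex_eq; rewrite ?cReM ?cImM /=.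
  under eq_Rintegral do rewrite cReM.
  by rewrite RintegralB ?RintegralZl //; exact: iZ.
under eq_Rintegral do rewrite cImM.
by rewrite RintegralD ?RintegralZl //; exact: iZ.
Qed.

Lemma cint0 : cint (fun=> 0) = 0.
Proof. by apply: complex_eq; rewrite /= Rintegral_cst // mul0r. Qed.

Lemma cint_sum (I : eqType) (s : seq I) (F : I -> R -> C) :
  (forall i, i \in s -> lg (F i)) ->
  cint (fun x => \sum_(i <- s) F i x) = \sum_(i <- s) cint (F i).
Proof.
elim: s => [|i s IH] Fl.
  rewrite big_nil; apply: etrans cint0.
  by apply: eq_cint => x _; rewrite big_nil.
have Fs k : k \in s -> lg (F k) by move=> ks; apply: Fl; rewrite inE ks orbT.
rewrite big_cons -IH // -cintD //; last exact: lg_sum.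
  by apply: eq_cint => x _; rewrite big_cons.
by apply: Fl; rewrite mem_head.
Qed.

Let real_dct (f : nat -> R -> R) (f0 : R -> R) K r :
  (forall n, measurable_fun circ (f n)) ->
  (forall n x, circ x -> `|f n x| <= K * sing x ^+ r) ->
  (forall x, circ x -> f n x @[n --> \oo] --> f0 x) ->
  (\int[mu]_(x in `]0, t[) f n x)%R @[n --> \oo] --> (\int[mu]_(x in `]0, t[) f0 x)%R.
Proof.
move=> mf fK ff.
have mfn n : measurable_fun `]0, t[ (EFin \o f n).
  by apply/measurable_EFinP; apply: (measurable_funS (@measurable_circ R) subset_circ).
have mf0 : measurable_fun `]0, t[ (EFin \o f0).
  apply/measurable_EFinP; apply: (measurable_funS (@measurable_circ R) subset_circ).
  exact: (measurable_fun_cvg mf ff).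
have cv : {ae mu, forall x, `]0, t[%classic x -> (EFin \o f n) x @[n --> \oo] --> (EFin \o f0) x}.
  apply: aeW => x /subset_circ cx; apply/cvg_EFin; first by near=> n.
  exact: ff.
have bd : {ae mu, forall x n, `]0, t[%classic x -> (`|(EFin \o f n) x| <= (K * sing x ^+ r)%:E)%E}.
  by apply: aeW => x n /subset_circ cx; rewrite lee_fin; exact: fK.
have [i0 _ lim] := @dominated_convergence _ _ R mu _ mt _ _ _ mfn mf0 cv (integrable_sing_t K r) bd.
rewrite /Rintegral; apply: fine_cvg; rewrite fineK //.
exact: integrable_fin_num.
Unshelve. all: by end_near. Qed.

Lemma cint_cvg (g : nat -> R -> C) g0 K r : (forall n, lgr K r (g n)) ->
  (forall x, circ x -> cvgc (g^~ x) (g0 x)) -> cvgc (fun n => cint (g n)) (cint g0).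
Proof.
move=> gl gg; split => /=.
  apply: (@real_dct (fun n x => Re (g n x)) _ K r).
  - by move=> n; have [] := gl n.
  - by move=> n x cx; have [_ _ h] := gl n; apply: le_trans (norm_Re_le _) (h x cx).
  - by move=> x cx; have [] := gg x cx.
apply: (@real_dct (fun n x => Im (g n x)) _ K r).
- by move=> n; have [] := gl n.
- by move=> n x cx; have [_ _ h] := gl n; apply: le_trans (norm_Im_le _) (h x cx).
- by move=> x cx; have [] := gg x cx.
Qed.

End Interval.

Lemma lgr_cvg (g : nat -> R -> C) g0 K r : (forall n, lgr K r (g n)) ->
  (forall x, circ x -> cvgc (g^~ x) (g0 x)) -> lgr K r g0.
Proof.
move=> gl gg; split.
- apply: (@measurable_fun_cvg _ _ _ _ (fun n x => Re (g n x))).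
    by move=> n; have [] := gl n.
  by move=> x cx; have [] := gg x cx.
- apply: (@measurable_fun_cvg _ _ _ _ (fun n x => Im (g n x))).
    by move=> n; have [] := gl n.
  by move=> x cx; have [] := gg x cx.
- move=> x cx; apply: (cvgc_cnorm1_le _ (gg x cx)) => n.
  by have [_ _] := gl n; exact.
Qed.

Definition cder (F f : R -> C) := forall x : R,
  is_derive x 1 (fun y => Re (F y)) (Re (f x)) /\
  is_derive x 1 (fun y => Im (F y)) (Im (f x)).

Lemma cder_cst z : cder (fun=> z) (fun=> 0).
Proof. by move=> x; split; exact: is_derive_cst. Qed.

Lemma cderD F f G g : cder F f -> cder G g ->
  cder (fun x => F x + G x) (fun x => f x + g x).
Proof.
move=> Ff Gg x; have [f1 f2] := Ff x; have [g1 g2] := Gg x; split.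
  rewrite cReD; under eq_fun do rewrite cReD.
  exact: (is_deriveD f1 g1).
rewrite cImD; under eq_fun do rewrite cImD.
exact: (is_deriveD f2 g2).
Qed.

Lemma cderM F f G g : cder F f -> cder G g ->
  cder (fun x => F x * G x) (fun x => f x * G x + F x * g x).
Proof.
move=> Ff Gg x; have [f1 f2] := Ff x; have [g1 g2] := Gg x; split.
  under eq_fun do rewrite cReM.
  have h := is_deriveB (is_deriveM f1 g1) (is_deriveM f2 g2).
  apply: (is_derive_eq (f := fun y => Re (F y) * Re (G y) - Im (F y) * Im (G y))).
  by rewrite /GRing.scale /= cReD !cReM; ring.
under eq_fun do rewrite cImM.
have h := is_deriveD (is_deriveM f1 g2) (is_deriveM f2 g1).
apply: (is_derive_eq (f := fun y => Re (F y) * Im (G y) + Im (F y) * Re (G y))).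
by rewrite /GRing.scale /= cImD !cImM; ring.
Qed.

Lemma eq_cder F F' f f' : F =1 F' -> f =1 f' -> cder F f -> cder F' f'.
Proof. by move=> /funext <- /funext <-. Qed.

Lemma cder_cont F f : cder F f ->
  continuous (fun x => Re (F x)) /\ continuous (fun x => Im (F x)).
Proof.
move=> Ff; split => x; have [[h1 _] [h2 _]] := Ff x;
  by apply: differentiable_continuous; apply/derivable1_diffP.
Qed.

Lemma cder_lg F f K : cder F f -> 0 <= K -> (forall x, circ x -> cnorm1 (F x) <= K) -> lg F.
Proof.
move=> /cder_cont[c1 c2] K0 FK; exists K, 0%N; split => //; split.
- apply: (measurable_funS measurableT (@subsetT _ _)).
  exact: continuous_measurable_fun.
- apply: (measurable_funS measurableT (@subsetT _ _)).
  exact: continuous_measurable_fun.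
- by move=> x cx; rewrite expr0 mulr1 FK.
Qed.

(** The derivative [f'] of the integrand enters only to supply its continuity. *)
Lemma cint_FTC F f f' (t : R) : 0 <= t -> cder F f -> cder f f' -> cint t f = F t - F 0.
Proof.
move=> t0 Ff ff'; have [c1 c2] := cder_cont ff'; have [C1 C2] := cder_cont Ff.
move: t0; rewrite le_eqVlt => /predU1P[<-|t0].
  rewrite subrr /cint set_itvoo0.
  by rewrite !Rintegral_set0.
have key (G g : R -> R) : (forall x : R, is_derive x 1 G (g x)) -> continuous g ->
    continuous G -> (\int[mu]_(x in `]0, t[) g x)%R = G t - G 0.
  move=> Gg cg cG.
  have mg (A : set R) : measurable_fun A (EFin \o g).
    apply/measurable_EFinP; apply: (measurable_funS measurableT (@subsetT _ _)).
    exact: continuous_measurable_fun.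
  rewrite /Rintegral integral_itv_obnd_cbnd; last exact: mg.
  rewrite integral_itv_bndo_bndc; last exact: mg.
  rewrite (@continuous_FTC2 _ _ G) //.
  - exact: continuous_subspaceT.
  - split.
    + by move=> x _; have [] := Gg x.
    + by apply: cvg_at_right_filter; apply: cG.
    + by apply: cvg_at_left_filter; apply: cG.
  - by move=> x _; rewrite derive1E; apply: derive_val.
apply: complex_eq; rewrite /= ?cReD ?cImD ?cReN ?cImN.
  exact: (key (fun x => Re (F x)) (fun x => Re (f x)) (fun x => (Ff x).1)).
exact: (key (fun x => Im (F x)) (fun x => Im (f x)) (fun x => (Ff x).2)).
Qed.

End ComplexCalculus.

(** * Absolutely convergent trigonometric series *)

Section TrigSeries.
Variable R : realType.
Notation C := R[i].
Notation circ := (@circ R).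
Implicit Types (b c : nat -> R) (x t : R) (m N M : nat) (P : nat -> C).

Definition ce m x : C := cos (m%:R * x) +i* sin (m%:R * x).
Definition ix x : C := 'i * x%:C.

Lemma natrC m : (m%:R : C) = (m%:R : R)%:C.
Proof. by rewrite rmorph_nat. Qed.

Lemma ce0 x : ce 0 x = 1.
Proof. by rewrite /ce mul0r cos0 sin0. Qed.

Lemma ceD m n x : ce (m + n) x = ce m x * ce n x.
Proof.
rewrite /ce natrD mulrDl cosD sinD; apply: complex_eq; rewrite ?cReM ?cImM //=.
by rewrite addrC.
Qed.

Lemma cnorm1_ce m x : cnorm1 (ce m x) <= 2.
Proof.
by rewrite /cnorm1 /= (_ : 2 = 1 + 1 :> R) // lerD // ?cos_max ?sin_max.
Qed.

Lemma cder_ce m : cder (ce m) (fun x => 'i * m%:R * ce m x).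
Proof.
move=> x; have h : is_derive x 1 (fun y : R => m%:R * y) m%:R.
  have := @is_deriveZ _ _ _ id m%:R x 1 1 (is_derive_id _ _).
  by rewrite /GRing.scale /= mulr1.
rewrite natrC; split.
  have h2 := @is_derive1_comp _ cos _ x _ _ (is_derive_cos _) h.
  apply: (is_derive_eq (f := fun y => Re (ce m y)) h2).
  by rewrite !cReM !cImM /=; ring.
have h2 := @is_derive1_comp _ sin _ x _ _ (is_derive_sin _) h.
apply: (is_derive_eq (f := fun y => Im (ce m y)) h2).
by rewrite !cImM !cReM /=; ring.
Qed.

Lemma cder_ix : cder ix (fun=> 'i).
Proof.
move=> x; split.
  have -> : (fun y => Re (ix y)) = cst 0.
    by apply/funext => y; rewrite /ix cReM /=; ring.
  exact: is_derive_cst.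
have -> : (fun y => Im (ix y)) = id.
  by apply/funext => y; rewrite /ix cImM /=; ring.
exact: is_derive_id.
Qed.

Lemma cder_ixX M : cder (fun x => ix x ^+ M) (fun x => M%:R * 'i * ix x ^+ M.-1).
Proof.
elim: M => [|M IH].
  by apply: eq_cder (cder_cst 1) => x; rewrite ?mul0r.
apply: eq_cder (cderM cder_ix IH) => x; first by rewrite exprS.
rewrite /= -natr1; case: M {IH} => [|M]; first by rewrite !mul0r expr0; ring.
by rewrite /= exprS; ring.
Qed.

Lemma lg_ix : lg ix.
Proof. by apply: lgM; [exact: lg_cst | exact: lg_id]. Qed.

Lemma lg_ce m : lg (ce m).
Proof. by apply: (cder_lg (cder_ce m) (ler0n R 2)) => x _; exact: cnorm1_ce. Qed.

(* Value of [M]-fold integration by parts: [P j] stands for the [(j+1)]-st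
   primitive, up to powers of ['i], of the factor that is integrated. *)
Definition ibp M (z : C) P : C :=
  \sum_(j < M.+1) (-1) ^+ j * (M`!%:R / (M - j)`!%:R) * z ^+ (M - j) * P j.

Lemma eq_ibp M z P Q : (forall j, P j = Q j) -> ibp M z P = ibp M z Q.
Proof. by move=> PQ; apply: eq_bigr => j _; rewrite PQ. Qed.

Lemma ibpZ M z a P : ibp M z (fun j => a * P j) = a * ibp M z P.
Proof. by rewrite /ibp mulr_sumr; apply: eq_bigr => j _; rewrite mulrCA. Qed.

Lemma ibp_sum (I : Type) (s : seq I) M z (P : I -> nat -> C) :
  ibp M z (fun j => \sum_(i <- s) P i j) = \sum_(i <- s) ibp M z (P i).
Proof. by rewrite exchange_big; apply: eq_bigr => j _; rewrite mulr_sumr. Qed.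

Lemma cvgc_ibp M z (P : nat -> nat -> C) Q : (forall j, cvgc (P^~ j) (Q j)) ->
  cvgc (fun n => ibp M z (P n)) (ibp M z Q).
Proof.
by move=> PQ; apply: cvgc_sum => j; apply: cvgcM => //; exact: cvgc_cst.
Qed.

Lemma ibp0 z P : ibp 0 z P = P 0%N.
Proof. by rewrite /ibp big_ord1 /= !expr0 divr1 !mul1r. Qed.

Lemma ibpS M z P :
  ibp M.+1 z P = z ^+ M.+1 * P 0%N - M.+1%:R * ibp M z (fun j => P j.+1).
Proof.
rewrite /ibp big_ord_recl /= subn0 expr0 mul1r divff ?mul1r; last first.
  by rewrite pnatr_eq0 -lt0n fact_gt0.
congr (_ + _); rewrite mulr_sumr -sumrN; apply: eq_bigr => j _.
rewrite /bump /= add1n subSS exprS factS natrM; ring.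
Qed.

(** Integrating i e^{imx} divides by m, and differentiating (ix)^M brings the factor i needed for
    the next round, so no power of i survives. The parameter [k] counts the primitives already taken
    and carries the induction on [M]. *)
Lemma cder_ibp_ce m M k : (0 < m)%N ->
  cder (fun x => ibp M (ix x) (fun j => (m%:R ^+ (j + k).+1)^-1 * ce m x))
       (fun x => 'i * ix x ^+ M * ce m x * (m%:R ^+ k)^-1).
Proof.
move=> m0; have mn0 : m%:R != 0 :> C by rewrite pnatr_eq0 -lt0n.
elim: M k => [|M IH] k.
  apply: eq_cder (cderM (cder_cst ((m%:R ^+ k.+1)^-1)) (cder_ce m)) => x.
    by rewrite ibp0.
  by rewrite expr0 exprS invfM; field; rewrite expf_neq0.
have h1 := cderM (cder_ixX M.+1)
  (cderM (cder_cst ((m%:R ^+ k.+1)^-1)) (cder_ce m)).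
have h2 := cderM (cder_cst (- M.+1%:R)) (IH k.+1).
apply: eq_cder (cderD h1 h2) => x.
  rewrite ibpS mulNr; congr (_ - _ * _).
  by apply: eq_ibp => j; rewrite addnS.
by rewrite /= [m%:R ^+ k.+1]exprS invfM; field; rewrite expf_neq0.
Qed.

Lemma lg_ix_ce m M : lg (fun x => 'i * ix x ^+ M * ce m x).
Proof.
apply: lgM; last exact: lg_ce.
by apply: lgM; [exact: lg_cst | apply: lgX; exact: lg_ix].
Qed.

Lemma cint_ix_ce m M t : (0 < m)%N -> 0 <= t ->
  cint t (fun x => 'i * ix x ^+ M * ce m x) =
  ibp M (ix t) (fun j => (m%:R ^+ j.+1)^-1 * ce m t) -
  ibp M (ix 0) (fun j => (m%:R ^+ j.+1)^-1 * ce m 0).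
Proof.
move=> m0 t0; have h := cder_ibp_ce M 0 m0.
have d := cderM (cderM (cder_cst 'i) (cder_ixX M)) (cder_ce m).
have e (x : R) : 'i * ix x ^+ M * ce m x * (m%:R ^+ 0)^-1 = 'i * ix x ^+ M * ce m x.
  by rewrite expr0 invr1 mulr1.
rewrite (cint_FTC t0 (eq_cder (frefl _) e h) d).
by congr (_ - _); apply: eq_ibp => j; rewrite addn0.
Qed.

Definition trigsum b N x : C := \sum_(m < N) (b m)%:C * ce m x.

Definition trig b x : C :=
  lim (Re (trigsum b N x) @[N --> \oo]) +i* lim (Im (trigsum b N x) @[N --> \oo]).

Definition sum_bounded b (K : R) := forall N, \sum_(m < N) `|b m| <= K.

Lemma sum_bounded_ge0 b K : sum_bounded b K -> 0 <= K.
Proof. by move=> /(_ 0%N); rewrite big_ord0. Qed.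

Lemma sum_bounded_le b c K : (forall m, `|c m| <= `|b m|) -> sum_bounded b K ->
  sum_bounded c K.
Proof. by move=> cb bK N; apply: le_trans (bK N); exact: ler_sum. Qed.

Lemma sum_bounded_cvg b K : sum_bounded b K -> cvgn (fun N => \sum_(m < N) b m).
Proof.
move=> bK; have -> : (fun N => \sum_(m < N) b m) = series b.
  by apply/funext => N; rewrite /series /= big_mkord.
apply: normed_cvg; apply: nondecreasing_is_cvgn.
  by apply: nondecreasing_series => n _ _ /=; exact: normr_ge0.
exists K => _ [N _ <-]; have := bK N.
by rewrite -(big_mkord xpredT (fun m => `|b m|)).
Qed.

Lemma Re_trigsum b N x : Re (trigsum b N x) = \sum_(m < N) b m * cos (m%:R * x).
Proof.
rewrite /trigsum (big_morph (@complex.Re R) (@cReD R) (erefl _)).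
by apply: eq_bigr => m _; rewrite cReM /= mul0r subr0.
Qed.

Lemma Im_trigsum b N x : Im (trigsum b N x) = \sum_(m < N) b m * sin (m%:R * x).
Proof.
rewrite /trigsum (big_morph (@complex.Im R) (@cImD R) (erefl _)).
by apply: eq_bigr => m _; rewrite cImM /= mul0r addr0.
Qed.

Lemma cvgc_trig b K x : sum_bounded b K -> cvgc (fun N => trigsum b N x) (trig b x).
Proof.
move=> bK; split => /=.
  have -> : (fun N => Re (trigsum b N x)) = (fun N => \sum_(m < N) b m * cos (m%:R * x)).
    by apply/funext => N; exact: Re_trigsum.
  apply: (@sum_bounded_cvg (fun m => b m * cos (m%:R * x)) K).
  apply: sum_bounded_le bK => m.
  by rewrite normrM ler_piMr // cos_max.
have -> : (fun N => Im (trigsum b N x)) = (fun N => \sum_(m < N) b m * sin (m%:R * x)).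
  by apply/funext => N; exact: Im_trigsum.
apply: (@sum_bounded_cvg (fun m => b m * sin (m%:R * x)) K).
apply: sum_bounded_le bK => m.
by rewrite normrM ler_piMr // sin_max.
Qed.

Lemma cnorm1_term_le (a : R) m x : cnorm1 (a%:C * ce m x) <= 2 * `|a|.
Proof.
by apply: le_trans (cnorm1M _ _) _; rewrite cnorm1_real mulrC ler_wpM2r // cnorm1_ce.
Qed.

Lemma cnorm1_trigsum b N x : cnorm1 (trigsum b N x) <= 2 * \sum_(m < N) `|b m|.
Proof.
apply: le_trans (cnorm1_sum _ _) _; rewrite mulr_sumr; apply: ler_sum => m _.
exact: cnorm1_term_le.
Qed.

Lemma lgr_trigsum b K N : sum_bounded b K -> lgr (2 * K) 0 (trigsum b N).
Proof.
move=> bK; have [K' [r' [_ [h1 h2 _]]]] : lg (trigsum b N).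
  by apply: lg_sum => m _; apply: lgM; [exact: lg_cst | exact: lg_ce].
split=> // x _; rewrite expr0 mulr1; apply: le_trans (cnorm1_trigsum _ _ _) _.
by rewrite ler_pM2l.
Qed.

Lemma lgr_trig b K : sum_bounded b K -> lgr (2 * K) 0 (trig b).
Proof.
move=> bK; apply: (lgr_cvg (fun N => lgr_trigsum N bK)) => x _.
exact: cvgc_trig bK.
Qed.

Lemma lg_trig b K : sum_bounded b K -> lg (trig b).
Proof.
move=> bK; exists (2 * K), 0%N; split; last exact: lgr_trig.
by rewrite mulr_ge0 ?(sum_bounded_ge0 bK).
Qed.

Lemma sum_bounded_div b K j : sum_bounded b K ->
  sum_bounded (fun m => (m%:R ^+ j)^-1 * b m) K.
Proof.
apply: sum_bounded_le => m; rewrite normrM ler_piMl // normfV ger0_norm ?exprn_ge0 //.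
case: m => [|m]; last by rewrite invf_le1 ?exprn_gt0 // exprn_ege1 // ler1n.
by case: j => [|j]; rewrite ?expr0 ?invr1 // expr0n invr0.
Qed.

Lemma cint_ix_trigsum b N M t : b 0%N = 0 -> 0 <= t -> t <= 2 * pi ->
  cint t (fun x => 'i * ix x ^+ M * trigsum b N x) =
  ibp M (ix t) (fun j => trigsum (fun m => (m%:R ^+ j.+1)^-1 * b m) N t) -
  ibp M (ix 0) (fun j => trigsum (fun m => (m%:R ^+ j.+1)^-1 * b m) N 0).
Proof.
move=> b0 t0 t2.
transitivity (cint t (fun x => \sum_(m < N) (b m)%:C * ('i * ix x ^+ M * ce m x))).
  by apply: eq_cint => // x _; rewrite mulr_sumr; apply: eq_bigr => m _; rewrite mulrCA.
rewrite cint_sum //; last first.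
  by move=> m _; apply: lgM; [exact: lg_cst | exact: lg_ix_ce].
have e y : ibp M (ix y) (fun j => trigsum (fun m => (m%:R ^+ j.+1)^-1 * b m) N y) =
    \sum_(m < N) (b m)%:C * ibp M (ix y) (fun j => (m%:R ^+ j.+1)^-1 * ce m y).
  rewrite /trigsum (ibp_sum _ M _ (fun (m : 'I_N) j => ((m%:R ^+ j.+1)^-1 * b m)%:C * ce m y)).
  apply: eq_bigr => m _; rewrite -ibpZ; apply: eq_ibp => j.
  rewrite rmorphM fmorphV rmorphXn rmorph_nat /=; ring.
rewrite !e -sumrB; apply: eq_bigr => -[[|m] mN] _ /=.
  rewrite cintZ //; last exact: lg_ix_ce.
  by rewrite b0 !mul0r subr0.
rewrite cintZ //; last exact: lg_ix_ce.
by rewrite cint_ix_ce // mulrBr.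
Qed.

(** Termwise integration by dominated convergence. A constant term would have no primitive of the
    form e^{imx}/m, whence [b 0 = 0]. *)
Lemma cint_ix_trig b K M t : sum_bounded b K -> b 0%N = 0 -> 0 <= t -> t <= 2 * pi ->
  cint t (fun x => 'i * ix x ^+ M * trig b x) =
  ibp M (ix t) (fun j => trig (fun m => (m%:R ^+ j.+1)^-1 * b m) t) -
  ibp M (ix 0) (fun j => trig (fun m => (m%:R ^+ j.+1)^-1 * b m) 0).
Proof.
move=> bK b0 t0 t2.
have [K' [r' [K'0 hl]]] : lg (fun x => 'i * ix x ^+ M).
  by apply: lgM; [exact: lg_cst | apply: lgX; exact: lg_ix].
have K0 : 0 <= 2 * K by rewrite mulr_ge0 // (sum_bounded_ge0 bK).
have h1 : cvgc (fun N => cint t (fun x => 'i * ix x ^+ M * trigsum b N x))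
               (cint t (fun x => 'i * ix x ^+ M * trig b x)).
  apply: (cint_cvg t2 (fun N => lgrM K'0 K0 hl (lgr_trigsum N bK))) => x _.
  by apply: cvgcM; [exact: cvgc_cst | exact: cvgc_trig bK].
apply: (cvgc_unique h1).
have -> : (fun N => cint t (fun x => 'i * ix x ^+ M * trigsum b N x)) = (fun N =>
    ibp M (ix t) (fun j => trigsum (fun m => (m%:R ^+ j.+1)^-1 * b m) N t) -
    ibp M (ix 0) (fun j => trigsum (fun m => (m%:R ^+ j.+1)^-1 * b m) N 0)).
  by apply/funext => N; exact: cint_ix_trigsum.
by apply: cvgcD; [|apply: cvgcN]; apply: cvgc_ibp => j; apply: cvgc_trig;
  apply: sum_bounded_div bK.
Qed.

End TrigSeries.

(** * Abel summation and the shuffle product *)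

Section Abel.
Variable R : realType.
Notation C := R[i].
Implicit Types (a b c : nat -> R) (x y : R) (m N : nat) (u v w : word).

(* Abel damping [z |-> rho z] with radius [rho = y ^ 4]; the fourth power leaves
   room for absorbing the factor [N ^ 2] in [cvgc_trigsum_cauchy_prod]. *)
Definition damp y a m : R := (y ^+ 4) ^+ m * a m.

Lemma sum_geometric_le y N : 0 <= y < 1 -> \sum_(m < N) y ^+ m <= (1 - y)^-1.
Proof.
move=> /andP[y0 y1]; have y10 : 0 < 1 - y by rewrite subr_gt0.
rewrite -[leRHS]mul1r ler_pdivlMr //.
have -> : (\sum_(m < N) y ^+ m) * (1 - y) = 1 - y ^+ N.
  elim: N => [|N IH]; first by rewrite big_ord0 mul0r expr0 subrr.
  by rewrite big_ord_recr /= mulrDl IH exprS; ring.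
by rewrite gerBl exprn_ge0.
Qed.

Lemma natr_expr_le y N : 0 <= y < 1 -> N%:R * y ^+ N <= (1 - y)^-1.
Proof.
move=> y01; have /andP[y0 y1] := y01; apply: le_trans (sum_geometric_le N y01).
rewrite -[N in N%:R]card_ord -sum1_card natr_sum mulr_suml.
apply: ler_sum => i _; rewrite mul1r.
by apply: ler_wiXn2l => //; [exact: ltW | exact: ltnW].
Qed.

Lemma sum_bounded_damp y a : 0 <= y < 1 -> (forall m, `|a m| <= 1) ->
  sum_bounded (damp y a) (1 - y)^-1.
Proof.
move=> y01 a1 N; have /andP[y0 y1] := y01.
apply: le_trans (sum_geometric_le N y01); apply: ler_sum => i _.
rewrite /damp normrM ger0_norm ?exprn_ge0 // -exprM.
apply: (@le_trans _ _ (y ^+ (4 * i))); first by rewrite ler_piMr ?exprn_ge0.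
by apply: ler_wiXn2l => //; [exact: ltW | exact: leq_pmull].
Qed.

Lemma sum_bounded_damp_le y a K : 0 <= y <= 1 -> sum_bounded a K ->
  sum_bounded (damp y a) K.
Proof.
move=> /andP[y0 y1]; apply: sum_bounded_le => m.
by rewrite /damp normrM ger0_norm ?exprn_ge0 // ler_piMl // !exprn_ile1 ?exprn_ge0.
Qed.

Lemma damp_cauchy_prod y a c m : damp y (cauchy_prod a c) m = cauchy_prod (damp y a) (damp y c) m.
Proof.
rewrite /damp /cauchy_prod mulr_sumr; apply: eq_bigr => i _.
have im : (i <= m)%N by rewrite -ltnS.
have -> : (y ^+ 4) ^+ m = (y ^+ 4) ^+ i * (y ^+ 4) ^+ (m - i) by rewrite -exprD subnKC.
by ring.
Qed.

Lemma trigsum_cauchy_prod b c N x : trigsum (cauchy_prod b c) N x =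
  \sum_(i < N) (b i)%:C * ce i x * trigsum c (N - i) x.
Proof.
elim: N => [|N IH]; first by rewrite /trigsum !big_ord0.
rewrite /trigsum big_ord_recr /= -/(trigsum _ N x) IH [RHS]big_ord_recr /=.
rewrite subSnn big_ord1 ce0 mulr1 /cauchy_prod big_ord_recr /= subnn rmorphD mulrDl.
rewrite addrA rmorphM /=; congr (_ + _); last by ring.
rewrite rmorph_sum mulr_suml -big_split; apply: eq_bigr => i _ /=.
have iN : (i <= N)%N by rewrite ltnW.
rewrite /trigsum subSn // big_ord_recr /= mulrDr; congr (_ + _).
rewrite -[in ce N](subnKC iN) ceD rmorphM /=; ring.
Qed.

Lemma cnorm1_trigsum_sub c (p : R) N i x : 0 <= p <= 1 -> (forall m, `|c m| <= p ^+ m) ->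
  (i <= N)%N -> cnorm1 (trigsum c N x - trigsum c (N - i) x) <= 2 * (i%:R * p ^+ (N - i)).
Proof.
move=> /andP[p0 p1] cp iN; rewrite /trigsum.
rewrite -(big_mkord xpredT (fun m => (c m)%:C * ce m x)).
rewrite -[in X in _ - X](big_mkord xpredT (fun m => (c m)%:C * ce m x)).
rewrite (@big_cat_nat _ _ _ (N - i)%N) ?leq_subr //= addrAC subrr add0r.
apply: le_trans (cnorm1_sum _ _) _.
apply: (@le_trans _ _ (\sum_(N - i <= m < N) 2 * p ^+ (N - i))).
  rewrite big_nat [leRHS]big_nat; apply: ler_sum => m /andP[m1 m2].
  apply: le_trans (cnorm1_term_le _ _ _) _; rewrite ler_pM2l //.
  by apply: le_trans (cp m) _; exact: ler_wiXn2l.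
by rewrite sumr_const_nat subKn // -[leLHS]mulr_natl mulrCA.
Qed.

(** The partial sum of the product series and the product of the partial sums differ by at most 4
    N^2 p^N, where p = y^4. This equals 4 (N y^N)^2 (y^2)^N, and N y^N is at most 1/(1 - y). *)
Lemma cvgc_trigsum_cauchy_prod y a c x : 0 <= y < 1 ->
  (forall m, `|a m| <= 1) -> (forall m, `|c m| <= 1) ->
  cvgc (fun N => trigsum (damp y (cauchy_prod a c)) N x)
       (trig (damp y a) x * trig (damp y c) x).
Proof.
move=> y01 a1 c1; have /andP[y0 y1] := y01.
have h := cvgcM (cvgc_trig x (sum_bounded_damp y01 a1))
                (cvgc_trig x (sum_bounded_damp y01 c1)).
pose D N := trigsum (damp y (cauchy_prod a c)) N x -
  trigsum (damp y a) N x * trigsum (damp y c) N x.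
have D0 : cvgc D 0; last first.
  have -> : (fun N => trigsum (damp y (cauchy_prod a c)) N x) =
      (fun N => D N + trigsum (damp y a) N x * trigsum (damp y c) N x).
    by apply/funext => N; rewrite /D subrK.
  by rewrite -[trig _ _ * _]add0r; exact: cvgcD.
set p := y ^+ 4.
have p01 : 0 <= p <= 1 by rewrite exprn_ge0 // exprn_ile1 // ltW.
have ap e m : (forall m, `|e m| <= 1) -> `|damp y e m| <= p ^+ m.
  move=> e1; have /andP[p0 p1] := p01.
  by rewrite /damp normrM ger0_norm ?exprn_ge0 // ler_piMr ?exprn_ge0.
pose B N := 4 * ((1 - y)^-1 ^+ 2 * (y ^+ 2) ^+ N).
apply: (@cvgc_cnorm1 _ _ _ B); last first.
  rewrite /B -[X in _ --> X](mulr0 4); apply: cvgM; first exact: cvg_cst.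
  rewrite -[X in _ --> X](mulr0 ((1 - y)^-1 ^+ 2)); apply: cvgM; first exact: cvg_cst.
  by apply: cvg_expr; rewrite ger0_norm ?exprn_ge0 // exprn_ilt1.
move=> N; rewrite subr0 /D.
have -> : trigsum (damp y (cauchy_prod a c)) N x =
    \sum_(i < N) (damp y a i)%:C * ce i x * trigsum (damp y c) (N - i) x.
  by rewrite -trigsum_cauchy_prod; apply: eq_bigr => i _; rewrite damp_cauchy_prod.
rewrite {2}/trigsum mulr_suml -sumrB; apply: le_trans (cnorm1_sum _ _) _.
apply: (@le_trans _ _ (\sum_(i < N) 4 * (N%:R * p ^+ N))).
  apply: ler_sum => i _; have iN : (i <= N)%N by rewrite ltnW.
  rewrite -mulrBr; apply: le_trans (cnorm1M _ _) _; rewrite -opprB cnorm1N.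
  apply: (@le_trans _ _ ((2 * p ^+ i) * (2 * (i%:R * p ^+ (N - i))))).
    apply: ler_pM; rewrite ?cnorm1_ge0 //.
      by apply: le_trans (cnorm1_term_le _ _ _) _; rewrite ler_pM2l // ap.
    by apply: cnorm1_trigsum_sub => // m; exact: ap.
  have -> : 2 * p ^+ i * (2 * (i%:R * p ^+ (N - i))) = 4 * (i%:R * (p ^+ i * p ^+ (N - i))).
    by ring.
  rewrite -exprD subnKC // ler_pM2l // ler_wpM2r ?ler_nat //.
  by have /andP[p0 _] := p01; rewrite exprn_ge0.
rewrite sumr_const card_ord -[leLHS]mulr_natl mulrCA ler_pM2l //.
have -> : N%:R * (N%:R * p ^+ N) = (N%:R * y ^+ N) ^+ 2 * (y ^+ 2) ^+ N.
  have -> : p ^+ N = (y ^+ N) ^+ 2 * (y ^+ 2) ^+ N.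
    by rewrite /p -!exprM -exprD; congr (_ ^+ _); lia.
  by ring.
rewrite ler_wpM2r ?exprn_ge0 // lerXn2r ?nnegrE ?natr_expr_le //.
  by rewrite mulr_ge0 ?exprn_ge0.
by rewrite invr_ge0 subr_ge0 ltW.
Qed.

(** The value L(w; rho e^{ix}) at radius rho = y^4. *)
Definition lser y w x : C := trig (damp y (wcoef R w)) x.

Lemma norm_wcoef_le1 w m : `|wcoef R w m| <= 1.
Proof. by rewrite ger0_norm ?wcoef_ge0 ?wcoef_le1. Qed.

Lemma sum_bounded_lser y w : 0 <= y < 1 -> sum_bounded (damp y (wcoef R w)) (1 - y)^-1.
Proof. by move=> y01; apply: sum_bounded_damp => // m; exact: norm_wcoef_le1. Qed.

Lemma lser_shw y u v x : 0 <= y < 1 -> adm u -> adm v ->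
  \sum_(w <- shw u v) lser y w x = lser y u x * lser y v x.
Proof.
move=> y01 ua va; apply: (cvgc_unique (u := fun N => trigsum (damp y (cauchy_prod (wcoef R u) (wcoef R v))) N x)).
  have -> : (fun N => trigsum (damp y (cauchy_prod (wcoef R u) (wcoef R v))) N x) =
      (fun N => \sum_(w <- shw u v) trigsum (damp y (wcoef R w)) N x).
    apply/funext => N; rewrite exchange_big; apply: eq_bigr => m _ /=.
    rewrite -mulr_suml -rmorph_sum; congr ((_)%:C * _).
    by rewrite /damp -mulr_sumr sum_shw_wcoef.
  by apply: cvgc_sum => w; exact: cvgc_trig (sum_bounded_lser w y01).
by apply: cvgc_trigsum_cauchy_prod => // m; exact: norm_wcoef_le1.
Qed.

Lemma big_shuffle (V : nmodType) (phi : word -> V) (A B : seq word) :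
  \sum_(w <- shuffle A B) phi w = \sum_(u <- A) \sum_(v <- B) \sum_(w <- shw u v) phi w.
Proof.
by rewrite /shuffle big_flatten big_allpairs_dep.
Qed.

Lemma mem_shuffle (A B : seq word) w : w \in shuffle A B ->
  exists u v, [/\ u \in A, v \in B & w \in shw u v].
Proof.
move=> /flattenP[s /allpairsP[[u v] /= [uA vB ->]] ws].
by exists u, v.
Qed.

Lemma adm_shuffle (A B : seq word) : all adm A -> all adm B -> all adm (shuffle A B).
Proof.
move=> /allP aA /allP aB; apply/allP => w /mem_shuffle[u [v [uA vB wuv]]].
exact: (allP (adm_shw (aA _ uA) (aB _ vB)) _ wuv).
Qed.

Lemma lser_shuffle y (A B : seq word) x : 0 <= y < 1 -> all adm A -> all adm B ->
  \sum_(w <- shuffle A B) lser y w x =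
  (\sum_(u <- A) lser y u x) * (\sum_(v <- B) lser y v x).
Proof.
move=> y01 /allP aA /allP aB; rewrite big_shuffle mulr_suml.
apply: eq_big_seq => u uA; rewrite mulr_sumr; apply: eq_big_seq => v vB.
by apply: lser_shw => //; [exact: aA | exact: aB].
Qed.

Lemma adm_e1_shpow r : all adm (e1_shpow r).
Proof. by elim: r => // r IH; exact: adm_shuffle. Qed.

Lemma size_e1_shpow r w : w \in e1_shpow r -> size w = r.
Proof.
elim: r w => [|r IH] w /=; first by rewrite inE => /eqP ->.
by move=> /mem_shuffle[u [v []]]; rewrite inE => /eqP -> /IH <- /size_shw ->.
Qed.

Lemma trig_delta x : trig (wcoef R [::]) x = 1.
Proof.
have e N : trigsum (wcoef R [::]) N.+1 x = 1.
  rewrite /trigsum big_ord_recl /= ce0 !mulr1 big1 ?addr0 // => i _.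
  by rewrite wcoef_nil /= mul0r.
have b1 : sum_bounded (wcoef R [::]) 1.
  move=> [|N]; first by rewrite big_ord0.
  rewrite big_ord_recl /= wcoef_nil normr1 big1 ?addr0 // => i _.
  by rewrite wcoef_nil normr0.
have := cvgc_shift (cvgc_trig x b1); under eq_fun do rewrite e.
by move=> h; apply: (cvgc_unique h (cvgc_cst 1)).
Qed.

Lemma lser_nil y x : lser y [::] x = 1.
Proof.
rewrite -[RHS](trig_delta x) /lser; congr trig; apply/funext => -[|m].
  by rewrite /damp expr0 mul1r.
by rewrite /damp wcoef_nil mulr0.
Qed.

Lemma lser_e1_shpow y r x : 0 <= y < 1 ->
  \sum_(w <- e1_shpow r) lser y w x = lser y [:: true] x ^+ r.
Proof.
move=> y01; elim: r => [|r IH]; first by rewrite big_seq1 lser_nil.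
by rewrite lser_shuffle ?adm_e1_shpow // IH big_seq1 exprS.
Qed.

(** Starting at 1/2 keeps rho = y^4 above 1/16, which the uniform bound on [Li_1] needs. *)
Definition abel_radius (n : nat) : R := 1 - n.+2%:R^-1.

Lemma abel_radiusP n : 1 / 2 <= abel_radius n < 1.
Proof.
rewrite /abel_radius; have : 0 < n.+2%:R^-1 :> R by rewrite invr_gt0 ltr0n.
have : n.+2%:R^-1 <= 2^-1 :> R by rewrite lef_pV2 ?posrE ?ltr0n // ler_nat.
by move: (n.+2%:R^-1 : R) => z h1 h2; apply/andP; split; lra.
Qed.

Lemma abel_radius01 n : 0 <= abel_radius n < 1.
Proof. by have /andP[h ->] := abel_radiusP n; rewrite andbT; lra. Qed.

Lemma cvg_abel_radius : abel_radius n @[n --> \oo] --> (1 : R).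
Proof.
rewrite /abel_radius -[X in _ --> X](subr0 1); apply: cvgB; first exact: cvg_cst.
have h := @cvg_harmonic R; rewrite -cvg_shiftS in h; exact: h.
Qed.

Lemma bernoulli_le y k : 0 <= y <= 1 -> 1 - y ^+ k <= k%:R * (1 - y).
Proof.
move=> /andP[y0 y1]; elim: k => [|k IH]; first by rewrite expr0 subrr mul0r.
rewrite exprS -natr1 mulrDl mul1r.
have -> : 1 - y * y ^+ k = y * (1 - y ^+ k) + (1 - y) by ring.
rewrite lerD2r; apply: le_trans IH.
by rewrite ler_piMl // subr_ge0 exprn_ile1.
Qed.

(** Abel's theorem in the absolutely convergent case: below a cut [M] the weights satisfy 1 - y^{4m}
    <= 4M(1 - y), and beyond it they are at most 1, leaving the tail of the sum of |b m|. *)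
Lemma cvgc_abel b K x : sum_bounded b K ->
  cvgc (fun n => trig (damp (abel_radius n) b) x) (trig b x).
Proof.
move=> bK.
pose S N := \sum_(m < N) `|b m|.
have Sc : cvgn S.
  by apply: (@sum_bounded_cvg _ (fun m => `|b m|) K) => N; under eq_bigr do rewrite normr_id.
have ndS : nondecreasing_seq S.
  by apply/nondecreasing_seqP => N; rewrite /S big_ord_recr /= lerDl.
have SL N : S N <= limn S by exact: nondecreasing_cvgn_le.
have bd n M : cnorm1 (trig (damp (abel_radius n) b) x - trig b x) <=
    2 * (limn S * ((4 * M)%:R * (1 - abel_radius n)) + (limn S - S M)).
  have /andP[y0 y1] := abel_radius01 n; set y := abel_radius n in y0 y1 *.
  have y01 : 0 <= y <= 1 by rewrite y0 ltW.
  apply: (@cvgc_cnorm1_le _ (fun N => trigsum (damp y b) N x - trigsum b N x)); last first.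
    apply: cvgcD; first exact: cvgc_trig (sum_bounded_damp_le y01 bK).
    by apply: cvgcN; exact: cvgc_trig bK.
  move=> N.
  have -> : trigsum (damp y b) N x - trigsum b N x =
      trigsum (fun m => - ((1 - (y ^+ 4) ^+ m) * b m)) N x.
    rewrite /trigsum -sumrB; apply: eq_bigr => m _; rewrite -mulrBl -rmorphB /=.
    by congr ((_)%:C * _); rewrite /damp; ring.
  apply: le_trans (cnorm1_trigsum _ _ _) _; rewrite ler_pM2l //.
  have w01 m : 0 <= 1 - (y ^+ 4) ^+ m <= 1.
    rewrite subr_ge0 gerBl -exprM; apply/andP; split.
      by rewrite exprn_ile1 // ltW.
    by rewrite exprn_ge0.
  (* Enlarging the range to [maxn M N] lets the sum be cut at [M] whatever [N] is. *)
  apply: (@le_trans _ _ (\sum_(m < maxn M N) (1 - (y ^+ 4) ^+ m) * `|b m|)).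
    rewrite -(big_mkord xpredT (fun m => `|- ((1 - (y ^+ 4) ^+ m) * b m)|)).
    rewrite -(big_mkord xpredT (fun m => (1 - (y ^+ 4) ^+ m) * `|b m|)).
    rewrite [leRHS](@big_cat_nat _ _ _ N) ?leq_maxr //=.
    rewrite -[leLHS]addr0; apply: lerD.
      apply: ler_sum => m _; rewrite normrN normrM ger0_norm //.
      by have /andP[] := w01 m.
    by apply: sumr_ge0 => m _; rewrite mulr_ge0 //; have /andP[] := w01 m.
  rewrite -(big_mkord xpredT (fun m => (1 - (y ^+ 4) ^+ m) * `|b m|)).
  rewrite (@big_cat_nat _ _ _ M) ?leq_maxl //=; apply: lerD.
    apply: (@le_trans _ _ (S M * ((4 * M)%:R * (1 - y)))); last first.
      by rewrite ler_wpM2r // mulr_ge0 // subr_ge0 ltW.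
    rewrite /S mulr_suml big_mkord; apply: ler_sum => m _.
    rewrite mulrC ler_wpM2l // -exprM; apply: le_trans (bernoulli_le _ y01) _.
    rewrite ler_wpM2r ?subr_ge0 ?(ltW y1) // ler_nat leq_mul2l /=.
    exact: ltnW.
  have -> : limn S - S M = limn S - S (maxn M N) + (S (maxn M N) - S M) by ring.
  have -> : S (maxn M N) - S M = \sum_(M <= m < maxn M N) `|b m|.
    rewrite /S -!(big_mkord xpredT (fun m => `|b m|)).
    by rewrite (@big_cat_nat _ _ _ M 0 (maxn M N)) ?leq_maxl //= addrAC subrr add0r.
  rewrite -[leLHS]add0r; apply: lerD; first by rewrite subr_ge0.
  apply: ler_sum => m _; rewrite ler_piMl //.
  by have /andP[] := w01 m.
apply: (@cvgc_cnorm1 _ _ _ (fun n => cnorm1 (trig (damp (abel_radius n) b) x - trig b x))) => //.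
apply/cvgrPdist_le => e e0.
have [M _ hM] : \forall M \near \oo, `|limn S - S M| <= e / 4.
  by move: Sc => /cvgrPdist_le; apply; rewrite divr_gt0.
have {}hM : limn S - S M <= e / 4 by apply: le_trans (ler_norm _) (hM M (leqnn M)).
have h0 : limn S * ((4 * M)%:R * (1 - abel_radius n)) @[n --> \oo] --> 0.
  rewrite -[X in _ --> X](mulr0 (limn S)); apply: cvgM; first exact: cvg_cst.
  rewrite -[X in _ --> X](mulr0 (4 * M)%:R); apply: cvgM; first exact: cvg_cst.
  by rewrite -[X in _ --> X](subrr 1); apply: cvgB; [exact: cvg_cst | exact: cvg_abel_radius].
move/cvgrPdist_le : h0 => /(_ (e / 4) (divr_gt0 e0 (ltr0n _ 4))) h0.
near=> n; rewrite sub0r normrN ger0_norm ?cnorm1_ge0 //; apply: le_trans (bd n M) _.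
have : `|0 - limn S * ((4 * M)%:R * (1 - abel_radius n))| <= e / 4 by near: n.
rewrite sub0r normrN => /(le_trans (ler_norm _)).
move: (limn S * _) (limn S - S M) hM => p q; lra.
Unshelve. all: by end_near. Qed.

End Abel.

(** * The logarithm on the unit circle *)

Section Logarithm.
Variable R : realType.
Notation C := R[i].
Notation circ := (@circ R).
Implicit Types (p x : R) (N : nat).

(* [|1 - p e^{ix}|^2] *)
Definition qnorm x p : R := 1 - 2 * p * cos x + p ^+ 2.

Lemma qnorm_ge x p : 0 <= p -> (1 - p) ^+ 2 <= qnorm x p.
Proof.
move=> p0; have := cos_le1 x; rewrite -subr_ge0 => /(mulr_ge0 p0) h.
rewrite /qnorm; lra.
Qed.

Lemma qnorm_gt0 x p : 0 <= p < 1 -> 0 < qnorm x p.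
Proof.
move=> /andP[p0 p1]; apply: lt_le_trans (qnorm_ge x p0).
by rewrite exprn_gt0 // subr_gt0.
Qed.

Lemma mulr_cos_lt1 x p : 0 <= p < 1 -> 0 < 1 - p * cos x.
Proof.
move=> /andP[p0 p1]; have := ler_wpM2l p0 (cos_le1 x); lra.
Qed.

(** Real part of the geometric sum of p^m e^{i(m+1)x}, cleared of its denominator |1 - p e^{ix}|^2.
    This sum is the derivative in p of the real part of a partial sum of Li_1(p e^{ix}). *)
Lemma geom_cos x p N : qnorm x p * \sum_(m < N) p ^+ m * cos (m.+1%:R * x) =
  cos x - p - p ^+ N * cos (N.+1%:R * x) + p ^+ N.+1 * cos (N%:R * x).
Proof.
elim: N => [|N IH]; first by rewrite big_ord0 mul0r cos0 !mul1r; ring.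
rewrite big_ord_recr /= mulrDr IH.
have -> : cos (N.+2%:R * x) = 2 * cos x * cos (N.+1%:R * x) - cos (N%:R * x).
  have -> : N.+2%:R * x = N.+1%:R * x + x by rewrite -[N.+2%:R]natr1; ring.
  have -> : N%:R * x = N.+1%:R * x - x by rewrite -[N.+1%:R]natr1; ring.
  by rewrite cosD cosB; ring.
by rewrite /qnorm !exprS; ring.
Qed.

Lemma geom_sin x p N : qnorm x p * \sum_(m < N) p ^+ m * sin (m.+1%:R * x) =
  sin x - p ^+ N * sin (N.+1%:R * x) + p ^+ N.+1 * sin (N%:R * x).
Proof.
elim: N => [|N IH]; first by rewrite big_ord0 mul0r sin0 !mul1r; ring.
rewrite big_ord_recr /= mulrDr IH.
have -> : sin (N.+2%:R * x) = 2 * cos x * sin (N.+1%:R * x) - sin (N%:R * x).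
  have -> : N.+2%:R * x = N.+1%:R * x + x by rewrite -[N.+2%:R]natr1; ring.
  have -> : N%:R * x = N.+1%:R * x - x by rewrite -[N.+1%:R]natr1; ring.
  by rewrite sinD sinB; ring.
by rewrite /qnorm !exprS; ring.
Qed.

Let isdM (f g : R -> R) (df dg p : R) : is_derive p 1 f df -> is_derive p 1 g dg ->
  is_derive p 1 (fun z => f z * g z) (df * g p + f p * dg).
Proof.
move=> hf hg; apply: (is_derive_eq (is_deriveM hf hg)).
by rewrite /GRing.scale /= addrC [g p * df]mulrC.
Qed.

Let isdZ (c : R) (f : R -> R) (df p : R) : is_derive p 1 f df ->
  is_derive p 1 (fun z => c * f z) (c * df).
Proof. by move=> hf; exact: (is_deriveZ c hf). Qed.

Let isdX (n : nat) (p : R) : is_derive p 1 (fun z : R => z ^+ n.+1) (n.+1%:R * p ^+ n).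
Proof.
elim: n => [|n IH]; first by rewrite mulr1; exact: is_derive_id.
have h := isdM IH (is_derive_id p (1 : R)).
have -> : (fun z : R => z ^+ n.+2) = (fun z => z ^+ n.+1 * z).
  by apply/funext => z; rewrite exprSr.
by apply: (is_derive_eq h); rewrite -[n.+2%:R]natr1 exprS; ring.
Qed.

Lemma is_derive_powsum (k : nat -> R) N (p : R) :
  is_derive p 1 (fun z : R => \sum_(m < N) m.+1%:R^-1 * z ^+ m.+1 * k m)
                (\sum_(m < N) p ^+ m * k m).
Proof.
elim: N => [|N IH].
  rewrite big_ord0; under eq_fun do rewrite big_ord0.
  exact: is_derive_cst.
rewrite big_ord_recr /=; under eq_fun do rewrite big_ord_recr /=.
have h : is_derive p 1 (fun z : R => N.+1%:R^-1 * z ^+ N.+1 * k N) (p ^+ N * k N).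
  have h2 := isdZ (N.+1%:R^-1 * k N) (isdX N p).
  have -> : (fun z : R => N.+1%:R^-1 * z ^+ N.+1 * k N) =
      (fun z => N.+1%:R^-1 * k N * z ^+ N.+1).
    by apply/funext => z; ring.
  apply: (is_derive_eq h2).
  have : N.+1%:R != 0 :> R by rewrite pnatr_eq0.
  by move: (N.+1%:R : R) => a a0; field.
exact: (is_deriveD IH h).
Qed.

Let is_derive_affine (a b p : R) : is_derive p 1 (fun z : R => a - z * b) (- b).
Proof.
have h := isdZ (- b) (is_derive_id p (1 : R)).
have := is_deriveD (is_derive_cst a p 1) h.
rewrite add0r mulr1 /=; congr is_derive; apply/funext => z /=.
by rewrite /= fctE /=; ring.
Qed.

Lemma is_derive_qnorm x p : is_derive p 1 (qnorm x) (2 * (p - cos x)).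
Proof.
have h := is_deriveD (is_derive_affine 1 (2 * cos x) p) (isdX 1 p).
have -> : qnorm x = (fun z : R => 1 - z * (2 * cos x)) + (fun z : R => z ^+ 2).
  by apply/funext => z; rewrite fctE /qnorm; ring.
by apply: (is_derive_eq h); ring.
Qed.

(** [logre] and [logim] are the real and imaginary parts of -log(1 - p e^{ix}); an arctangent gives
    the argument because 1 - p cos x is positive for 0 <= p < 1. *)
Definition logre x p : R := - (1 / 2) * ln (qnorm x p).
Definition logim x p : R := atan (p * sin x / (1 - p * cos x)).

Lemma is_derive_logre x p : 0 <= p < 1 ->
  is_derive p 1 (logre x) ((cos x - p) / qnorm x p).
Proof.
move=> p01; have q0 := qnorm_gt0 x p01.
have h1 := @is_derive1_comp _ (@ln R) (qnorm x) p _ _ (is_derive1_ln q0) (is_derive_qnorm x p).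
have h2 := @is_deriveZ _ _ _ _ (- (1 / 2)) _ _ _ h1.
apply: (is_derive_eq (f := logre x) h2); rewrite /GRing.scale /=.
by field; rewrite gt_eqF.
Qed.

Lemma is_derive_logim x p : 0 <= p < 1 ->
  is_derive p 1 (logim x) (sin x / qnorm x p).
Proof.
move=> p01; have q0 := qnorm_gt0 x p01; have d0 := mulr_cos_lt1 x p01.
have hd := is_derive_affine 1 (cos x) p.
have hV := @is_deriveV _ (fun z : R => 1 - z * cos x) p _ _ (lt0r_neq0 d0) hd.
have hq := isdM (isdZ (sin x) (is_derive_id p (1 : R))) hV.
have h1 := @is_derive1_comp _ (@atan R) _ p _ _ (is_derive1_atan _) hq.
have -> : logim x = atan \o (fun z : R => sin x * z * (1 - z * cos x)^-1).
  by apply/funext => z; rewrite /logim /= [_ * sin x]mulrC.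
apply: (is_derive_eq h1); rewrite /= /GRing.scale /=.
have e : qnorm x p = (1 - p * cos x) ^+ 2 + (p * sin x) ^+ 2.
  rewrite /qnorm; have := cos2Dsin2 x; move: (cos x) (sin x) => c s cs.
  have -> : (1 - p * c) ^+ 2 + (p * s) ^+ 2 = 1 - 2 * p * c + p ^+ 2 * (c ^+ 2 + s ^+ 2) by ring.
  by rewrite cs mulr1.
rewrite e; rewrite e in q0; move: (cos x) (sin x) d0 q0 => c s d0 q0.
field; rewrite !gt_eqF //=.
Qed.

Lemma mvt_bound (f df : R -> R) (p B : R) : 0 <= p <= 1 -> f 0 = 0 ->
  (forall z, 0 <= z <= p -> is_derive z 1 f (df z)) ->
  (forall z, 0 <= z <= p -> `|df z| <= B) -> `|f p| <= B.
Proof.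
move=> /andP[p0 p1] f0 dff dfB.
have cf : {within `[0, p], continuous f}.
  apply: continuous_in_subspaceT => z; rewrite inE /= in_itv /= => zi.
  have [h _] := dff z zi.
  by apply: differentiable_continuous; apply/derivable1_diffP.
have dff' z : z \in `]0, p[ -> is_derive z 1 f (df z).
  by rewrite in_itv /= => /andP[z0 zp]; apply: dff; rewrite !ltW.
have [c cp] := MVT_segment p0 dff' cf.
have B0 : 0 <= B by apply: le_trans (dfB 0 _); rewrite ?normr_ge0 // lexx.
rewrite f0 !subr0 => ->; rewrite normrM (ger0_norm p0).
have cB : `|df c| <= B by apply: dfB; move: cp; rewrite in_itv.
by apply: le_trans (ler_piMr _ p1) cB.
Qed.

Lemma qnorm_quotient_le x (z p c c' : R) N : 0 <= z <= p -> p < 1 ->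
  `|c| <= 1 -> `|c'| <= 1 ->
  `|(z ^+ N * c - z ^+ N.+1 * c') / qnorm x z| <= 2 * ((1 - p) ^- 2 * p ^+ N).
Proof.
move=> /andP[z0 zp] p1 c1 c1'; have p0 := le_trans z0 zp.
have z01 : 0 <= z < 1 by rewrite z0 (le_lt_trans zp).
have q0 := qnorm_gt0 x z01.
rewrite normrM normfV (gtr0_norm q0) [_^-1 * _]mulrC mulrA.
have zN : z ^+ N <= p ^+ N by rewrite lerXn2r ?nnegrE.
have zS : z ^+ N.+1 <= p ^+ N.
  apply: le_trans zN; rewrite exprS ler_piMl ?exprn_ge0 //.
  by have /andP[_ /ltW] := z01.
apply: ler_pM; rewrite ?normr_ge0 ?invr_ge0 ?(ltW q0) //.
  apply: le_trans (ler_normB _ _) _; rewrite mulrDl !mul1r.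
  by apply: lerD; rewrite normrM ger0_norm ?exprn_ge0 //;
    (apply: le_trans (ler_piMr _ _) _; rewrite ?exprn_ge0).
rewrite lef_pV2 ?posrE ?exprn_gt0 ?subr_gt0 //.
apply: le_trans (qnorm_ge x z0); rewrite lerXn2r ?nnegrE ?subr_ge0 ?(ltW p1) //.
  by have /andP[_ /ltW] := z01.
by rewrite lerB.
Qed.

(** Both terms vanish at p = 0, and their derivatives in p differ exactly by the remainder of the
    geometric sum, which is small uniformly on [0, p]. *)
Lemma logre_approx x p N : 0 <= p < 1 ->
  `|logre x p - \sum_(m < N) m.+1%:R^-1 * p ^+ m.+1 * cos (m.+1%:R * x)|
  <= 2 * ((1 - p) ^- 2 * p ^+ N).
Proof.
move=> /andP[p0 p1].
apply: (@mvt_bound (fun z => logre x z - \sum_(m < N) m.+1%:R^-1 * z ^+ m.+1 * cos (m.+1%:R * x))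
  (fun z => (z ^+ N * cos (N.+1%:R * x) - z ^+ N.+1 * cos (N%:R * x)) / qnorm x z)).
- by rewrite p0 ltW.
- rewrite /logre /qnorm mulr0 mul0r subr0 expr0n addr0 ln1 mulr0 big1 ?subr0 // => i _.
  by rewrite expr0n mulr0 mul0r.
- move=> z /andP[z0 zp]; have z01 : 0 <= z < 1 by rewrite z0 (le_lt_trans zp).
  have h := is_deriveB (is_derive_logre x z01) (is_derive_powsum (fun m => cos (m.+1%:R * x)) N z).
  apply: (is_derive_eq h); have q0 := qnorm_gt0 x z01.
  apply: (@mulfI _ (qnorm x z)); first by rewrite gt_eqF.
  by rewrite mulrBr geom_cos; field; rewrite gt_eqF.
- by move=> z zp; apply: qnorm_quotient_le => //; exact: cos_max.
Qed.

Lemma logim_approx x p N : 0 <= p < 1 ->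
  `|logim x p - \sum_(m < N) m.+1%:R^-1 * p ^+ m.+1 * sin (m.+1%:R * x)|
  <= 2 * ((1 - p) ^- 2 * p ^+ N).
Proof.
move=> /andP[p0 p1].
apply: (@mvt_bound (fun z => logim x z - \sum_(m < N) m.+1%:R^-1 * z ^+ m.+1 * sin (m.+1%:R * x))
  (fun z => (z ^+ N * sin (N.+1%:R * x) - z ^+ N.+1 * sin (N%:R * x)) / qnorm x z)).
- by rewrite p0 ltW.
- rewrite /logim !mul0r atan0 big1 ?subr0 // => i _.
  by rewrite expr0n mulr0 mul0r.
- move=> z /andP[z0 zp]; have z01 : 0 <= z < 1 by rewrite z0 (le_lt_trans zp).
  have h := is_deriveB (is_derive_logim x z01) (is_derive_powsum (fun m => sin (m.+1%:R * x)) N z).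
  apply: (is_derive_eq h); have q0 := qnorm_gt0 x z01.
  apply: (@mulfI _ (qnorm x z)); first by rewrite gt_eqF.
  by rewrite mulrBr geom_sin; field; rewrite gt_eqF.
- by move=> z zp; apply: qnorm_quotient_le => //; exact: sin_max.
Qed.

Lemma lser_e1 y x : 0 <= y < 1 ->
  lser y [:: true] x = logre x (y ^+ 4) +i* logim x (y ^+ 4).
Proof.
move=> y01; have /andP[y0 y1] := y01; set p := y ^+ 4.
have p01 : 0 <= p < 1 by rewrite exprn_ge0 // exprn_ilt1.
have /andP[p0 p1] := p01.
have h := cvgc_shift (cvgc_trig x (sum_bounded_lser [:: true] y01)).
have wE m : wcoef R [:: true] m.+1 = m.+1%:R^-1.
  rewrite -[[:: true]]/(rcons [::] true) wcoef_rcons big_ord_recl /= big1 ?addr0 ?mulr1 //.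
have B0 : 2 * ((1 - p) ^- 2 * p ^+ N) @[N --> \oo] --> (0 : R).
  rewrite -[X in _ --> X](mulr0 2); apply: cvgM; first exact: cvg_cst.
  rewrite -[X in _ --> X](mulr0 ((1 - p) ^- 2)); apply: cvgM; first exact: cvg_cst.
  by apply: cvg_expr; rewrite ger0_norm.
apply: (cvgc_unique h).
apply: (@cvgc_cnorm1 _ _ _ (fun N => 2 * ((1 - p) ^- 2 * p ^+ N) + 2 * ((1 - p) ^- 2 * p ^+ N))).
  move=> N; rewrite /cnorm1 cReD cImD cReN cImN /=.
  rewrite Re_trigsum Im_trigsum !big_ord_recl /= /damp.
  rewrite wcoef_at0 // !mulr0 !mul0r !add0r.
  have e (k : R -> R) : \sum_(i < N) p ^+ (bump 0 i) * wcoef R [:: true] (bump 0 i) *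
      k ((bump 0 i)%:R * x) = \sum_(m < N) m.+1%:R^-1 * p ^+ m.+1 * k (m.+1%:R * x).
    by apply: eq_bigr => i _; rewrite /bump /= add1n wE [p ^+ _ * _]mulrC.
  rewrite !e; apply: lerD; rewrite distrC.
    exact: logre_approx.
  exact: logim_approx.
by rewrite -[X in _ --> X](addr0 0); apply: cvgD.
Qed.

Definition Lam x : C := (- Afun x) +i* ((pi - x) / 2).

Lemma sin_half_sqr x : 2 - 2 * cos x = 4 * sin (x / 2) ^+ 2.
Proof.
have {1}-> : x = x / 2 *+ 2 by rewrite -mulr_natr; field.
by rewrite cos_mulr2n -mulr_natr cos2sin2; ring.
Qed.

Lemma logre1 x : circ x -> logre x 1 = - Afun x.
Proof.
move=> /sin_half_circ /andP[s0 s1]; rewrite /logre /Afun.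
have -> : qnorm x 1 = (2 * sin (x / 2)) ^+ 2.
  rewrite /qnorm exprMn expr1n mulr1 (_ : 2 ^+ 2 = 4 :> R); last by ring.
  by rewrite -sin_half_sqr; ring.
rewrite lnXn ?mulr_gt0 // ger0_norm ?mulr_ge0 ?ltW // -mulr_natr.
by field.
Qed.

(** The argument of the arctangent is cot(x/2) = tan((pi - x)/2), and (pi - x)/2 lies in the
    principal range. *)
Lemma logim1 x : circ x -> logim x 1 = (pi - x) / 2.
Proof.
move=> cx; have /andP[s0 s1] := sin_half_circ cx; have /circP /andP[x0 x2] := cx.
rewrite /logim !mul1r -[RHS]tanK; last by rewrite in_itv /=; apply/andP; split; lra.
congr atan; rewrite /tan.
have -> : (pi - x) / 2 = - (x / 2 - pi / 2) by field.
rewrite sinN cosN sinBpihalf cosBpihalf opprK.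
have e : 1 - cos x = 2 * sin (x / 2) ^+ 2 by have := sin_half_sqr x; lra.
rewrite e; have {1}-> : x = x / 2 *+ 2 by rewrite -mulr_natr; field.
rewrite sin_mulr2n -[(_ * _) *+ 2]mulr_natr.
by field; rewrite gt_eqF.
Qed.

(** [cvgc_abel] does not apply, since the coefficients 1/m are not summable; the limit is read off
    the closed form. *)
Lemma cvgc_lser_e1 x : circ x -> cvgc (fun n => lser (abel_radius R n) [:: true] x) (Lam x).
Proof.
move=> cx; have /andP[s0 s1] := sin_half_circ cx.
have -> : (fun n => lser (abel_radius R n) [:: true] x) =
    (fun n => logre x (abel_radius R n ^+ 4) +i* logim x (abel_radius R n ^+ 4)).
  by apply/funext => n; rewrite lser_e1 ?abel_radius01.
have p1 : abel_radius R n ^+ 4 @[n --> \oo] --> (1 : R).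
  rewrite -(expr1n _ 4).
  apply: (@cvg_comp _ _ _ (abel_radius R) (fun z => z ^+ 4) _ (nbhs (1 : R))); first exact: cvg_abel_radius.
  exact: exprn_continuous.
have q1 : 0 < qnorm x 1.
  have -> : qnorm x 1 = 4 * sin (x / 2) ^+ 2.
    by rewrite -sin_half_sqr /qnorm; ring.
  by rewrite mulr_gt0 // exprn_gt0.
split; rewrite /= -?(logre1 cx) -?(logim1 cx).
- apply: cvgM; first exact: cvg_cst.
  apply: (@cvg_comp _ _ _ (fun n => qnorm x (abel_radius R n ^+ 4)) (@ln R) _ (nbhs (qnorm x 1))).
    apply: cvgD; last by apply: cvgM.
    apply: cvgB; first exact: cvg_cst.
    by apply: cvgM; [apply: cvgM => //; exact: cvg_cst | exact: cvg_cst].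
  exact: continuous_ln.
- apply: (@cvg_comp _ _ _ (fun n => abel_radius R n ^+ 4 * sin x / (1 - abel_radius R n ^+ 4 * cos x))
    (@atan R) _ (nbhs (1 * sin x / (1 - 1 * cos x)))).
    apply: cvgM; first by apply: cvgM => //; exact: cvg_cst.
    apply: cvgV; last first.
      by apply: cvgB; [exact: cvg_cst | apply: cvgM => //; exact: cvg_cst].
    rewrite mul1r; have : 0 < 4 * sin (x / 2) ^+ 2 by rewrite mulr_gt0 // exprn_gt0.
    by rewrite -sin_half_sqr => h; rewrite gt_eqF //; lra.
  exact: continuous_atan.
Qed.

Lemma measurable_lser y w : 0 <= y < 1 ->
  measurable_fun circ (fun x => Re (lser y w x)) /\
  measurable_fun circ (fun x => Im (lser y w x)).
Proof. by move=> y01; have [] := lgr_trig (sum_bounded_lser w y01). Qed.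

(** With s = sin(x/2), |1 - p e^{ix}|^2 = (1 - p)^2 + 4 p s^2 lies between (s/2)^2 and 4 because
    1/16 <= p < 1. So the real part is at most 2 - ln s and the imaginary part at most pi/2 < 2,
    both in absolute value. *)
Lemma lgr_lser_e1 n : lgr 4 1 (lser (abel_radius R n) [:: true]).
Proof.
have [m1 m2] := measurable_lser [:: true] (abel_radius01 R n).
split => // x cx; rewrite lser_e1 ?abel_radius01 // /cnorm1 /= expr1.
have /andP[y0 y1] := abel_radiusP R n; set p := abel_radius R n ^+ 4.
have p1 : p < 1 by rewrite exprn_ilt1 //; lra.
have p0 : 1 / 16 <= p.
  have -> : 1 / 16 = (1 / 2) ^+ 4 :> R by field.
  by rewrite lerXn2r ?nnegrE //; lra.
have /andP[s0 s1] := sin_half_circ cx; set s := sin (x / 2) in s0 s1.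
have S1 : sing x = 1 + `|ln s| by [].
have qE : qnorm x p = (1 - p) ^+ 2 + 4 * p * s ^+ 2.
  have -> : (1 - p) ^+ 2 + 4 * p * s ^+ 2 = (1 - p) ^+ 2 + p * (4 * s ^+ 2) by ring.
  by rewrite -sin_half_sqr /qnorm; ring.
have ss0 : 0 < s ^+ 2 by rewrite exprn_gt0.
have ss1 : s ^+ 2 <= 1 by rewrite exprn_ile1 // ltW.
have q1 : (s / 2) ^+ 2 <= qnorm x p.
  rewrite qE -mulrA; have := sqr_ge0 (1 - p).
  have : 1 / 16 * s ^+ 2 <= p * s ^+ 2 by rewrite ler_pM2r.
  have -> : (s / 2) ^+ 2 = s ^+ 2 / 4 by field.
  by move: (p * s ^+ 2) ((1 - p) ^+ 2) => a b h1 h2; lra.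
have q2 : qnorm x p <= 2 ^+ 2.
  rewrite qE -mulrA; have : p * s ^+ 2 <= p by rewrite ler_piMr //; lra.
  have -> : (1 - p) ^+ 2 = 1 - 2 * p + p * p by ring.
  have : p * p <= p by rewrite ler_piMr //; lra.
  by move: (p * s ^+ 2) (p * p) => a b h1 h2; lra.
have sh0 : 0 < s / 2 by lra.
have q0 : 0 < qnorm x p by apply: lt_le_trans q1; rewrite exprn_gt0.
have l1 : 2 * (ln s - ln 2) <= ln (qnorm x p).
  rewrite -ln_div ?posrE // mulrC mulr_natr -lnXn // ler_ln ?posrE //.
  by rewrite exprn_gt0.
have l2 : ln (qnorm x p) <= 2 * ln 2.
  by rewrite mulrC mulr_natr -lnXn // ler_ln ?posrE // exprn_gt0.
have l3 : ln 2 < 2 :> R by exact: ln_sublinear.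
have l4 : ln s <= 0 by exact: ln_le0.
have l5 := pihalf_lt2 R; have l6 := atan_ltpi2 (p * sin x / (1 - p * cos x)).
have l7 := atan_gtNpi2 (p * sin x / (1 - p * cos x)).
have h1 : `|logre x p| <= 2 - ln s.
  rewrite /logre ler_norml; apply/andP; split; lra.
have h2 : `|logim x p| <= 2 by rewrite /logim ler_norml; apply/andP; split; lra.
by rewrite S1 (ler0_norm l4); lra.
Qed.

Lemma lg_Lam : lg Lam.
Proof.
by exists 4, 1%N; split => //; exact: (lgr_cvg lgr_lser_e1 cvgc_lser_e1).
Qed.

End Logarithm.

(** * The primitives [f] *)

Section Primitive.
Variable R : realType.
Notation C := R[i].
Notation circ := (@circ R).
Implicit Types (x t : R) (u w : word) (M N : nat).

Notation tr w := (trig (wcoef R w)).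

(** Absolute convergence on the circle. It holds for the empty word and for words ending in [e_0],
    and hence for all words that occur in [w_jr]. *)
Definition sumw w := exists K, sum_bounded (wcoef R w) K.

Lemma sumw_nil : sumw [::].
Proof.
exists 1 => -[|N]; first by rewrite big_ord0.
rewrite big_ord_recl /= wcoef_nil normr1 big1 ?addr0 // => i _.
by rewrite wcoef_nil normr0.
Qed.

Lemma sumw_cat_nseq w n : sumw (w ++ nseq n.+1 false).
Proof.
have -> : w ++ nseq n.+1 false = rcons (w ++ nseq n false) false.
  by rewrite -cats1 -catA -[[:: false]]/(nseq 1 false) -nseqD addn1.
have [K bK] := sum_wcoef_rcons_false_bounded R (w ++ nseq n false).
exists K => N; apply: le_trans (bK N); apply: ler_sum => i _.
by rewrite ger0_norm // wcoef_ge0.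
Qed.

Lemma lg_tr w : sumw w -> lg (tr w).
Proof. by move=> [K /lg_trig]. Qed.

(** The new constants are chosen before [h], so that one bound serves the whole sequence of
    radii. *)
Lemma lgrX (K : R) (r k : nat) : 0 <= K ->
  exists (K' : R) (r' : nat), 0 <= K' /\ forall h : R -> C, lgr K r h -> lgr K' r' (fun x => h x ^+ k).
Proof.
move=> K0; elim: k => [|k [K' [r' [K'0 IH]]]].
  by exists (cnorm1 (1 : C)), 0%N; split => [|h _]; [exact: cnorm1_ge0 | exact: lgr_cst].
exists (K * K'), (r + r')%N; split; first exact: mulr_ge0.
move=> h hl; under eq_fun do rewrite exprS.
by apply: lgrM => //; exact: IH.
Qed.

(* Prove it with [e^{ix}] replaced by [rho e^{ix}], where all series converge
   absolutely and shuffles are products, and let [rho] tend to [1]. *)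
Lemma cint_tr_Lam u (r : nat) M t : adm u -> sumw u -> (0 < size u + r)%N ->
  0 <= t -> t <= 2 * pi ->
  cint t (fun x => 'i * ix x ^+ M * (tr u x * Lam x ^+ r)) =
  ibp M (ix t) (fun j => \sum_(w <- shuffle [:: u] (e1_shpow r)) tr (w ++ nseq j.+1 false) t) -
  ibp M (ix 0) (fun j => \sum_(w <- shuffle [:: u] (e1_shpow r)) tr (w ++ nseq j.+1 false) 0).
Proof.
move=> ua [K uK] ur t0 t2; set B := shuffle _ _.
(* Nonempty words have vanishing constant coefficient, as termwise integration requires. *)
have B0 w : w \in B -> w != [::].
  move=> /mem_shuffle[u' [v [+ vr wuv]]]; rewrite inE => /eqP u'E.
  by rewrite -size_eq0 (size_shw wuv) (size_e1_shpow vr) u'E -lt0n.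
have y01 n := abel_radius01 R n.
pose y n := abel_radius R n.
have hL : cvgc (fun n => cint t (fun x => 'i * ix x ^+ M * (lser (y n) u x * lser (y n) [:: true] x ^+ r)))
    (cint t (fun x => 'i * ix x ^+ M * (tr u x * Lam x ^+ r))).
  have [K1 [r1 [K10 h1]]] : lg (fun x => 'i * ix x ^+ M).
    by apply: lgM; [exact: lg_cst | apply: lgX; exact: lg_ix].
  have K0 : 0 <= 2 * K by rewrite mulr_ge0 // (sum_bounded_ge0 uK).
  have h2 n : lgr (2 * K) 0 (lser (y n) u).
    apply: lgr_trig; apply: sum_bounded_damp_le uK.
    by have /andP[-> /ltW] := y01 n.
  have [K3 [r3 [K30 h3]]] := lgrX 1 r (ler0n R 4).
  apply: (cint_cvg t2 (fun n => lgrM K10 (mulr_ge0 K0 K30) h1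
    (lgrM K0 K30 (h2 n) (h3 _ (lgr_lser_e1 R n))))) => x cx.
  apply: cvgcM; first exact: cvgc_cst.
  apply: cvgcM; first exact: cvgc_abel uK.
  by apply: cvgcX; exact: cvgc_lser_e1.
apply: (cvgc_unique hL).
have -> : (fun n => cint t (fun x => 'i * ix x ^+ M * (lser (y n) u x * lser (y n) [:: true] x ^+ r)))
  = (fun n =>
  ibp M (ix t) (fun j => \sum_(w <- B) lser (y n) (w ++ nseq j.+1 false) t) -
  ibp M (ix 0) (fun j => \sum_(w <- B) lser (y n) (w ++ nseq j.+1 false) 0)).
  apply/funext => n.
  transitivity (cint t (fun x => \sum_(w <- B) 'i * ix x ^+ M * lser (y n) w x)).
    apply: eq_cint => // x _; rewrite -mulr_sumr lser_shuffle ?adm_e1_shpow //=; last by rewrite ua.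
    by rewrite big_seq1 lser_e1_shpow.
  rewrite cint_sum //; last first.
    move=> w _; apply: lgM; last exact: lg_trig (sum_bounded_lser w (y01 n)).
    by apply: lgM; [exact: lg_cst | apply: lgX; exact: lg_ix].
  rewrite !ibp_sum -sumrB; apply: eq_big_seq => w /B0 w0.
  rewrite (cint_ix_trig _ (sum_bounded_lser w (y01 n))) //; last first.
    by rewrite /damp wcoef_at0 // mulr0.
  have e j z : trig (fun m => (m%:R ^+ j.+1)^-1 * damp (y n) (wcoef R w) m) z =
      lser (y n) (w ++ nseq j.+1 false) z.
    by congr trig; apply/funext => m; rewrite /damp wcoef_cat_nseq mulrCA.
  by congr (_ - _); apply: eq_ibp => j; rewrite e.
(* The words on the right all end in [e_0], so Abel's theorem applies to each of them at both
   endpoints. *)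
by apply: cvgcD; [|apply: cvgcN]; apply: cvgc_ibp => j; apply: cvgc_sum => w;
  have [K' bK'] := sumw_cat_nseq w j; exact: cvgc_abel bK'.
Qed.

Lemma cint_trs_Lam (A : seq word) (r : nat) M t :
  (forall u, u \in A -> [/\ adm u, sumw u & (0 < size u + r)%N]) ->
  0 <= t -> t <= 2 * pi ->
  cint t (fun x => 'i * ix x ^+ M * ((\sum_(u <- A) tr u x) * Lam x ^+ r)) =
  ibp M (ix t) (fun j => \sum_(w <- shuffle A (e1_shpow r)) tr (w ++ nseq j.+1 false) t) -
  ibp M (ix 0) (fun j => \sum_(w <- shuffle A (e1_shpow r)) tr (w ++ nseq j.+1 false) 0).
Proof.
move=> hA t0 t2.
have e (phi : word -> C) : \sum_(w <- shuffle A (e1_shpow r)) phi w =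
    \sum_(u <- A) \sum_(w <- shuffle [:: u] (e1_shpow r)) phi w.
  by rewrite big_shuffle; apply: eq_bigr => u _; rewrite big_shuffle big_seq1.
transitivity (\sum_(u <- A) cint t (fun x => 'i * ix x ^+ M * (tr u x * Lam x ^+ r))).
  rewrite -cint_sum //.
    by apply: eq_cint => // x _; rewrite mulr_suml mulr_sumr.
  move=> u /hA[_ us _]; apply: lgM.
    by apply: lgM; [exact: lg_cst | apply: lgX; exact: lg_ix].
  by apply: lgM; [exact: lg_tr | apply: lgX; exact: lg_Lam].
have e2 z : ibp M (ix z) (fun j => \sum_(w <- shuffle A (e1_shpow r)) tr (w ++ nseq j.+1 false) z) =
    \sum_(u <- A) ibp M (ix z) (fun j => \sum_(w <- shuffle [:: u] (e1_shpow r)) tr (w ++ nseq j.+1 false) z).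
  by rewrite -ibp_sum; apply: eq_ibp => j; rewrite e.
rewrite !e2 -sumrB; apply: eq_big_seq => u /hA[ua us ur].
exact: cint_tr_Lam.
Qed.

Lemma Li_circ_tr w x : adm w -> sumw w -> Li_circ (word_index w) x = tr w x.
Proof.
move=> wa [K wK]; have [->|w0] := eqVneq w [::]; first by rewrite trig_delta.
have [ks [k [-> H]]] := wcoef_harm R wa w0.
rewrite /Li_circ rev_rcons.
have [h1 h2] := cvgc_shift (cvgc_trig x wK).
have e (g : R -> R) N : \sum_(1 <= m < N.+1) (g (m%:R * x) * (m%:R ^+ k)^-1 * harm R (rev ks) m) =
    \sum_(m < N.+1) wcoef R w m * g (m%:R * x).
  rewrite big_ord_recl /= wcoef_at0 // mul0r add0r big_add1 /= big_mkord.
  by apply: eq_bigr => i _; rewrite /bump /= add1n H //; ring.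
apply: complex_eq => /=.
  apply: cvg_lim => //; under eq_fun do rewrite e -Re_trigsum.
  exact: h1.
apply: cvg_lim => //; under eq_fun do rewrite e -Im_trigsum.
exact: h2.
Qed.

Lemma w_jr_rcons j r a b : size j = size r -> w_jr (rcons j a) (rcons r b) =
  [seq w ++ nseq a.+1 false | w <- shuffle (w_jr j r) (e1_shpow b)].
Proof. by move=> jr; rewrite /w_jr zip_rcons // rev_rcons. Qed.

(** A positive first entry of [r] makes the words begin with [e_1]; the default 1 of [head] lets the
    empty index through. The last letter of a nonempty word comes from the factor e_0^{1+j}, which
    yields [sumw]. *)
Lemma mem_w_jr j r w : size j = size r -> (0 < head 1 r)%N -> w \in w_jr j r ->
  [/\ adm w, sumw w & (0 < size r -> 0 < size w)%N].
Proof.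
elim/last_ind: r j w => [|r b IH] j w; case/lastP: j => [|j a]; rewrite ?size_rcons //.
  by rewrite inE => _ _ /eqP ->; split => //; exact: sumw_nil.
case=> jr r0; rewrite w_jr_rcons // => /mapP[v /mem_shuffle[u [e [uw eb vue]]] ->].
have r0' : (0 < head 1 r)%N by case: r r0 {IH jr uw}.
have [ua us u0] := IH _ _ jr r0' uw.
have v0 : v != [::].
  rewrite -size_eq0 (size_shw vue) (size_e1_shpow eb) -lt0n addn_gt0.
  by case: r r0 u0 {IH jr uw r0'} => [/= ->|x r _ ->]; rewrite ?orbT.
split; last by rewrite size_cat /= addnS.
  rewrite adm_cat //; apply: (allP (adm_shw ua _) _ vue).
  exact: (allP (adm_e1_shpow b) _ eb).
exact: sumw_cat_nseq.
Qed.

Lemma mem_bseqs m N (s : seq nat) : (s \in bseqs m N) = (size s == m) && all (fun y : nat => y <= N)%N s.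
Proof.
elim: m s => [|m IH] [|x s] //.
  by apply/negbTE/negP => /allpairsP[[y v] []].
apply/idP/idP.
  move=> /allpairsP[[y v] [yN vm [-> ->]]]; move: yN vm.
  by rewrite mem_iota IH add0n ltnS /= => -> /andP[/eqP <- ->]; rewrite eqxx.
move=> /andP[sm /= /andP[xN aN]].
rewrite -[X in _ \in X]/[seq y :: v | y <- iota 0 N.+1, v <- bseqs m N].
apply/allpairsP; exists (x, s); split => //.
  by rewrite mem_iota add0n ltnS.
by rewrite IH aN andbT.
Qed.

Lemma uniq_bseqs m N : uniq (bseqs m N).
Proof.
elim: m => // m IH.
rewrite -[bseqs _ _]/[seq y :: v | y <- iota 0 N.+1, v <- bseqs m N].
apply: allpairs_uniq; rewrite ?iota_uniq //.
by move=> [a b] [c d] _ _ [-> ->].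
Qed.

Definition below q : seq (seq nat) := [seq j <- bseqs (size q) (sumn q) | prec j q].

Lemma mem_below q j : (j \in below q) = prec j q.
Proof.
rewrite mem_filter mem_bseqs; case p : (prec j q) => //=.
move: p => /andP[sz /allP h]; rewrite sz /=; apply/allP => x xj.
have j0 : (0 < size j)%N by case: j xj {h sz}.
have := h (size j); rewrite mem_iota add1n ltnSn j0 take_size => /(_ isT).
rewrite take_oversize ?(eqP sz) //; apply: leq_trans.
move: xj; elim: j {h sz j0} => //= y j IH; rewrite inE => /orP[/eqP ->|/IH].
  exact: leq_addr.
by move=> xj; apply: leq_trans xj (leq_addl _ _).
Qed.

Lemma uniq_below q : uniq (below q).
Proof. by rewrite filter_uniq // uniq_bseqs. Qed.

Lemma prec_size j q : prec j q -> size j = size q.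
Proof. by move=> /andP[/eqP]. Qed.

Lemma prec_sumn j q : prec j q -> (sumn j <= sumn q)%N.
Proof.
case: j => [|x j] /andP[/eqP sz /allP h]; first by case: q sz h.
have := h (size (x :: j)); rewrite mem_iota add1n ltnSn take_size => /(_ isT).
by rewrite sz take_size.
Qed.

Lemma prec_rcons j q (y a : nat) :
  prec (rcons j y) (rcons q a) = prec j q && (sumn j + y <= sumn q + a)%N.
Proof.
rewrite /prec !size_rcons eqSS; case: eqP => // sz; rewrite !andTb.
rewrite -[X in iota _ X]addn1 iotaD all_cat /= andbT add1n.
rewrite !take_oversize ?size_rcons ?sz // !sumn_rcons; congr (_ && _).
apply: eq_in_all => i; rewrite mem_iota add1n ltnS => /andP[_ iq].
by rewrite -!cats1 !takel_cat ?sz.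
Qed.

(** The last entry of [j] ranges freely from 0 to |q| + a - |j|, precisely the range of summation in
    [ibp] for that exponent. *)
Lemma big_below_rcons (phi : seq nat -> C) q a :
  \sum_(j <- below (rcons q a)) phi j =
  \sum_(j <- below q) \sum_(y < (sumn q + a - sumn j).+1) phi (rcons j y).
Proof.
under [RHS]eq_bigr do rewrite -(big_mkord xpredT (fun y => phi (rcons _ y))).
transitivity (\sum_(j <- [seq rcons j y | j <- below q,
    y <- index_iota 0 (sumn q + a - sumn j).+1]) phi j); last first.
  by rewrite big_allpairs_dep.
apply: perm_big; apply: uniq_perm; first exact: uniq_below.
  apply: allpairs_uniq_dep; first exact: uniq_below.
    by move=> j _; exact: iota_uniq.
  by move=> [j x] [j' x'] _ _ /= /rcons_inj[-> ->].
move=> j; rewrite mem_below; apply/idP/allpairsPdep.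
  case/lastP: j => [|j x]; first by case/andP; rewrite size_rcons.
  rewrite prec_rcons => /andP[p s]; exists j, x; split => //; first by rewrite mem_below.
  by rewrite mem_index_iota /= ltnS leq_subRL // (leq_trans (prec_sumn p)) // leq_addr.
move=> [j' [x [+ + ->]]]; rewrite mem_below mem_index_iota /= ltnS => p.
by rewrite leq_subRL ?prec_rcons ?p // (leq_trans (prec_sumn p)) // leq_addr.
Qed.

(** The sum in [f_qr] once the leading zeros of [r] have been absorbed, without the factor [Bq]. *)
Definition gsum q r x : C := \sum_(j <- below q)
  (Cqj q j * ix x ^+ (sumn q - sumn j) * Lw (w_jr j r) x).

Lemma gsum_nil x : gsum [::] [::] x = 1.
Proof.
rewrite /gsum /below /= big_seq1 /Cqj /Lw /w_jr /= big_seq1 /Li_circ /=.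
by rewrite expr0 !mulr1.
Qed.

Lemma Lw_tr j r x : size j = size r -> (0 < head 1 r)%N ->
  Lw (w_jr j r) x = \sum_(w <- w_jr j r) tr w x.
Proof.
move=> jr r0; apply: eq_big_seq => w /(mem_w_jr jr r0)[wa ws _].
exact: Li_circ_tr.
Qed.

Lemma lg_gsum q r : size q = size r -> (0 < head 1 r)%N -> lg (gsum q r).
Proof.
move=> qr r0; apply: lg_sum => j; rewrite mem_below => p.
have jr : size j = size r by rewrite (prec_size p).
apply: lgM; first by apply: lgM; [exact: lg_cst | apply: lgX; exact: lg_ix].
apply: (@eq_lg _ (fun x => \sum_(w <- w_jr j r) tr w x)).
  by move=> x _; rewrite Lw_tr.
by apply: lg_sum => w /(mem_w_jr jr r0)[_ ws _]; exact: lg_tr.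
Qed.

(** Put M = |q| + a - |j|. The last factor of [Cqj] is (-1)^y M!/(M - y)!, and [w_jr] shuffles with
    e_1^b before appending e_0^{1+y}; so the sum over the last entry y is the [ibp] that integrates
    (ix)^M L(w_j) Lam^b. The hypothesis on [rcons r b] keeps the integrated words nonempty. *)
Lemma gsum_step q r a b t : size q = size r -> (0 < head 1 (rcons r b))%N ->
  0 <= t -> t <= 2 * pi ->
  gsum (rcons q a) (rcons r b) t - gsum (rcons q a) (rcons r b) 0 =
  cint t (fun x => 'i * ix x ^+ a * Lam x ^+ b * gsum q r x).
Proof.
move=> qr rb0 t0 t2.
have r0 : (0 < head 1 r)%N by case: (r) rb0.
have gE z : gsum (rcons q a) (rcons r b) z = \sum_(j <- below q) Cqj q j *
    ibp (sumn q + a - sumn j) (ix z)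
      (fun k => \sum_(w <- shuffle (w_jr j r) (e1_shpow b)) tr (w ++ nseq k.+1 false) z).
  rewrite /gsum big_below_rcons; apply: eq_big_seq => j; rewrite mem_below => p.
  have jr : size j = size r by rewrite (prec_size p).
  rewrite /ibp mulr_sumr; apply: eq_bigr => k _.
  rewrite Lw_tr ?size_rcons ?jr // w_jr_rcons // big_map.
  rewrite /Cqj !rev_rcons /= !sumn_rcons !sumn_rev [(a + _)%N]addnC.
  rewrite [(k + _)%N]addnC subnDA; ring.
rewrite !gE -sumrB.
transitivity (\sum_(j <- below q) cint t (fun x => Cqj q j *
   ('i * ix x ^+ (sumn q + a - sumn j) * ((\sum_(u <- w_jr j r) tr u x) * Lam x ^+ b)))).
  apply: eq_big_seq => j; rewrite mem_below => p.
  have jr : size j = size r by rewrite (prec_size p).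
  rewrite cintZ //; last first.
    apply: lgM; first by apply: lgM; [exact: lg_cst | apply: lgX; exact: lg_ix].
    apply: lgM; last by apply: lgX; exact: lg_Lam.
    by apply: lg_sum => w /(mem_w_jr jr r0)[_ ws _]; exact: lg_tr.
  rewrite -mulrBr cint_trs_Lam // => u /(mem_w_jr jr r0)[ua us u0]; split => //.
  rewrite addn_gt0; case: (r) u0 rb0 => [|z r'] /= u0 b0; first by rewrite b0 orbT.
  by rewrite u0.
rewrite -cint_sum //; last first.
  move=> j; rewrite mem_below => p; have jr : size j = size r by rewrite (prec_size p).
  apply: lgM; first exact: lg_cst.
  apply: lgM; first by apply: lgM; [exact: lg_cst | apply: lgX; exact: lg_ix].
  apply: lgM; last by apply: lgX; exact: lg_Lam.
  by apply: lg_sum => w /(mem_w_jr jr r0)[_ ws _]; exact: lg_tr.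
apply: eq_cint => // x _; rewrite /gsum mulr_sumr; apply: eq_big_seq => j.
rewrite mem_below => p; have jr : size j = size r by rewrite (prec_size p).
rewrite Lw_tr //.
have -> : (sumn q + a - sumn j)%N = (a + (sumn q - sumn j))%N.
  by rewrite addnC addnBA // prec_sumn.
rewrite exprD; ring.
Qed.

End Primitive.

(** * Integral recursion for f in its last entry *)

Section Recursion.
Variable R : realType.
Notation C := R[i].
Notation circ := (@circ R).
Implicit Types (x t : R) (q r k l : seq nat) (a b n : nat).

Lemma f_zero q n x : size q = n ->
  f_qr q (nseq n 0%N) x = Bq q * ix x ^+ (sumn q + n).
Proof.
move=> <-; rewrite /f_qr.
have -> : find (fun y => y != 0)%N (nseq (size q) 0%N) = size q.
  by rewrite hasNfind ?size_nseq // has_nseq andbF.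
cbv zeta; rewrite take_size drop_size drop_oversize ?size_nseq //= big_seq1 /Cqj /Lw /w_jr /= big_seq1 /Li_circ /=.
by rewrite mul1r mulr1 subn0.
Qed.

(** The block of leading zeros contributes B (ix)^{|q'| + n'}; its power of ix is absorbed in the
    next entry, which is how the barred index arises. *)
Lemma f_split q' c q3 r x : size (c :: q3) = size r -> (0 < head 1 r)%N ->
  f_qr (q' ++ c :: q3) (nseq (size q') 0%N ++ r) x =
  Bq q' * gsum ((sumn q' + size q' + c)%N :: q3) r x.
Proof.
move=> sz r0; rewrite /f_qr.
have -> : find (fun y => y != 0)%N (nseq (size q') 0%N ++ r) = size q'.
  rewrite find_cat has_nseq andbF size_nseq; case: r sz r0 => //= y r _ y0.
  by rewrite -lt0n y0 addn0.
cbv zeta; rewrite take_size_cat // drop_size_cat // drop_size_cat ?size_nseq //.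
congr (_ * _); apply: eq_bigr => j _; congr (_ * _ ^+ _ * _).
by rewrite sumn_cat /=; lia.
Qed.

Lemma zero_prefix r : exists n r'', r = nseq n 0%N ++ r'' /\ (0 < head 1 r'')%N.
Proof.
elim: r => [|[|y] r [n [r'' [-> r0]]]]; first by exists 0%N, [::].
  by exists n.+1, r''.
by exists 0%N, (y.+1 :: nseq n 0%N ++ r'').
Qed.

Lemma Bq_rcons q a : Bq (rcons q a) = (sumn q + a + (size q).+1)%:R^-1 * Bq q :> C.
Proof. by rewrite /Bq rev_rcons /= sumn_rev size_rev [(a + _)%N]addnC. Qed.

Lemma lg_ixM M : lg (fun x => 'i * ix x ^+ M).
Proof. by apply: lgM; [exact: lg_cst | apply: lgX; exact: lg_ix]. Qed.

Lemma lg_kernel a b (g : R -> C) : lg g ->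
  lg (fun x => 'i * ix x ^+ a * Lam x ^+ b * g x).
Proof.
move=> gl; apply: lgM => //; apply: lgM; first exact: lg_ixM.
by apply: lgX; exact: lg_Lam.
Qed.

Lemma cint_ixM M t : 0 <= t -> t <= 2 * pi ->
  cint t (fun x => 'i * ix x ^+ M) = M.+1%:R^-1 * (ix t ^+ M.+1 - ix 0 ^+ M.+1).
Proof.
move=> t0 t2; have n0 : M.+1%:R != 0 :> C by rewrite pnatr_eq0.
have h := cderM (cder_cst (M.+1%:R^-1 : C)) (@cder_ixX R M.+1).
have h' := cderM (cder_cst ('i : C)) (@cder_ixX R M).
rewrite (cint_FTC (F := fun x => M.+1%:R^-1 * ix x ^+ M.+1) t0 _ h').
  by rewrite mulrBr.
by apply: eq_cder h => // x; rewrite /= mul0r add0r !mulrA mulVf // mul1r.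
Qed.

Lemma f_nil x : f_qr [::] [::] x = 1 :> C.
Proof. by rewrite (@f_zero [::] 0%N) //= expr0 mulr1. Qed.

Lemma zero_prefix2 q r : size q = size r -> exists q' q'' r'',
  [/\ q = q' ++ q'', r = nseq (size q') 0%N ++ r'', size q'' = size r'' &
      (0 < head 1 r'')%N].
Proof.
move=> qr; have [n [r'' [rE r0]]] := zero_prefix r.
have nq : (n <= size q)%N by rewrite qr rE size_cat size_nseq leq_addr.
exists (take n q), (drop n q), r''; split => //; first by rewrite cat_take_drop.
  by rewrite size_takel.
by rewrite size_drop qr rE size_cat size_nseq addKn.
Qed.

(** Three cases. If [rcons r b] is all zero, a pure power is integrated, and the new denominator is
    the next factor of [Bq]. If [r] is zero but [b] is not, the first [e_1] appears and [gsum_step]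
    starts from the empty index with the merged exponent. Otherwise [gsum_step] applies directly and
    [Bq q'] is a constant factor. *)
Lemma f_step q r a b t : size q = size r -> 0 <= t -> t <= 2 * pi ->
  f_qr (rcons q a) (rcons r b) t - f_qr (rcons q a) (rcons r b) 0 =
  cint t (fun x => 'i * ix x ^+ a * Lam x ^+ b * f_qr q r x).
Proof.
move=> qr t0 t2; have [q' [q'' [r'' [-> ->]]]] := zero_prefix2 qr.
case: r'' q'' => [|z r''] [|c q''] // sz r0.
  rewrite !cats0; case: b => [|b].
    have -> : rcons (nseq (size q') 0%N) 0%N = nseq (size q').+1 0%N.
      by rewrite -cats1 -addn1 nseqD.
    rewrite !f_zero ?size_rcons // sumn_rcons Bq_rcons addnS.
    transitivity (cint t (fun x => Bq q' * ('i * ix x ^+ (sumn q' + a + size q')))).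
      rewrite cintZ //; last exact: lg_ixM.
      by rewrite cint_ixM // -mulrBr; ring.
    apply: eq_cint => // x _; rewrite expr0 mulr1 f_zero //.
    rewrite [(sumn q' + a)%N]addnC -addnA exprD; ring.
  rewrite -!cats1 !f_split // -mulrBr (@gsum_step R [::] [::]) //.
  transitivity (cint t (fun x => Bq q' * ('i * ix x ^+ (sumn q' + size q' + a) *
      Lam x ^+ b.+1 * gsum [::] [::] x))).
    by rewrite cintZ //; apply: lg_kernel; exact: lg_gsum.
  apply: eq_cint => // x _; rewrite gsum_nil f_zero // addnC exprD; ring.
rewrite !rcons_cat !rcons_cons !f_split //; last 2 first.
- by rewrite /= !size_rcons; case: sz => ->.
- by rewrite /= !size_rcons; case: sz => ->.
rewrite -mulrBr -!rcons_cons gsum_step //.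
transitivity (cint t (fun x => Bq q' * ('i * ix x ^+ a * Lam x ^+ b *
    gsum ((sumn q' + size q' + c)%N :: q'') (z :: r'') x))).
  by rewrite cintZ //; apply: lg_kernel; exact: lg_gsum.
by apply: eq_cint => // x _; rewrite f_split //; ring.
Qed.

Lemma lg_f q r : size q = size r -> lg (f_qr q r : R -> C).
Proof.
move=> qr; have [q' [q'' [r'' [-> ->]]]] := zero_prefix2 qr.
case: r'' q'' => [|z r''] [|c q''] // sz r0.
  apply: (@eq_lg _ (fun x => Bq q' * ix x ^+ (sumn q' + size q'))).
    by move=> x _; rewrite !cats0 f_zero.
  by apply: lgM; [exact: lg_cst | apply: lgX; exact: lg_ix].
apply: (@eq_lg _ (fun x => Bq q' *
  gsum ((sumn q' + size q' + c)%N :: q'') (z :: r'') x)).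
  by move=> x _; rewrite f_split.
by apply: lgM; [exact: lg_cst | exact: lg_gsum].
Qed.

(** * The functions [F] as iterated integrals *)

Lemma compsF_fuel n m : (m <= n)%N -> compsF n m = compositions m.
Proof.
rewrite /compositions; have [N] := ubnP m; elim: N m n => // N IH m n; rewrite ltnS => mN mn.
case: m n mN mn => [|m] [|n] // mN mn; rewrite /= ; congr (_ ++ flatten _).
  congr map; rewrite subn1 /= (IH m n) ?(IH m m) //.
apply/eq_in_map => i; rewrite mem_iota => /andP[i0 _]; congr map.
by rewrite (IH (m.+1 - i.+1)%N n) ?(IH (m.+1 - i.+1)%N m) //; lia.
Qed.

Lemma big_compositions (phi : seq nat -> C) m :
  \sum_(c <- compositions m.+1) phi c =
  \sum_(i < m.+1) \sum_(c <- compositions (m - i)) phi (i.+1 :: c).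
Proof.
have -> : compositions m.+1 =
    flatten [seq [seq i.+1 :: c | c <- compositions (m - i)] | i <- iota 0 m.+1].
  rewrite -[LHS]/(flatten [seq [seq i.+1 :: c | c <- compsF m (m.+1 - i.+1)] | i <- iota 0 m.+1]).
  congr flatten; apply/eq_map => i; congr map.
  by rewrite subSS compsF_fuel // leq_subr.
rewrite big_flatten big_map -[iota 0 m.+1]/(index_iota 0 m.+1) big_mkord.
by apply: eq_bigr => i _; rewrite big_map.
Qed.

Definition Fterm q r x (c : seq nat) : C :=
  let qs := blocks c q in let rs := blocks c r in let h := size c in
  (-1) ^+ (h.-1)
  * (\prod_(i < h.-1) f_qr (nth [::] qs i) (nth [::] rs i) 0)
  * (f_qr (nth [::] qs h.-1) (nth [::] rs h.-1) x
     - f_qr (nth [::] qs h.-1) (nth [::] rs h.-1) 0).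

Lemma Fterm_cons q r x i c : c != [::] -> Fterm q r x (i :: c) =
  - (f_qr (take i q) (take i r) 0 * Fterm (drop i q) (drop i r) x c).
Proof.
case: c => // i' c _; rewrite /Fterm /= big_ord_recl /= exprS; ring.
Qed.

Lemma F_sum q r x m : size q = m.+1 ->
  F_qr q r x = \sum_(c <- compositions m.+1) Fterm q r x c.
Proof. by rewrite /F_qr => ->. Qed.

Lemma nil_notin_compositions m : (0 < m)%N -> [::] \notin compositions m.
Proof.
case: m => // m _; apply/negP => /flattenP[s /mapP[i _ ->]].
by case/mapP.
Qed.

(** Compositions are grouped by their first block, each further block bringing a sign. The
    single-block term is f(x) - f(0), whose constant is the last summand because [F_qr [::] [::]] is
    1; this also makes the formula hold for the empty index. *)
Lemma F_rec q r x : size q = size r ->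
  F_qr q r x = f_qr q r x - \sum_(i < size q)
    f_qr (take i.+1 q) (take i.+1 r) 0 * F_qr (drop i.+1 q) (drop i.+1 r) x.
Proof.
move=> qr; case E : (size q) => [|m].
  have r0 : r = [::] by apply: size0nil; rewrite -qr.
  by rewrite r0 (size0nil E) big_ord0 subr0 f_nil.
have E' : size r = m.+1 by rewrite -qr.
have tq : take m.+1 q = q by rewrite -E take_size.
have dq : drop m.+1 q = [::] by rewrite -E drop_size.
have tr : take m.+1 r = r by rewrite -E' take_size.
have dr : drop m.+1 r = [::] by rewrite -E' drop_size.
rewrite (F_sum _ _ E) big_compositions !big_ord_recr /= subnn big_seq1 tq dq tr dr.
have -> : Fterm q r x [:: m.+1] = f_qr q r x - f_qr q r 0.
  by rewrite /Fterm /= big_ord0 tq tr !mul1r.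
rewrite [F_qr [::] [::] x]/(1); set S := \sum_(i < m) _; set S' := \sum_(i < m) _.
suff -> : S = - S' by ring.
rewrite /S /S' -sumrN; apply: eq_bigr => i _.
have im : (0 < m - i)%N by rewrite subn_gt0.
have sd : size (drop i.+1 q) = (m - i).-1.+1 by rewrite size_drop E subSS prednK.
rewrite (F_sum _ _ sd) prednK // mulr_sumr -sumrN; apply: eq_big_seq => c cm.
rewrite Fterm_cons //; apply/eqP => c0; move: cm; rewrite c0; apply/negP.
exact: nil_notin_compositions.
Qed.

Lemma lg_F q r : size q = size r -> lg (F_qr q r : R -> C).
Proof.
have [n] := ubnP (size q); elim: n q r => // n IH q r; rewrite ltnS => qn qr.
apply: (@eq_lg _ (fun x => f_qr q r x + \sum_(i < size q)
    (- f_qr (take i.+1 q) (take i.+1 r) 0) * F_qr (drop i.+1 q) (drop i.+1 r) x)).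
  by move=> x _; rewrite [RHS]F_rec // -sumrN; congr (_ + _); apply: eq_bigr => i _; rewrite mulNr.
apply: lgD; first exact: lg_f.
apply: lg_sum => i _; apply: lgM; first exact: lg_cst.
have iq : (i < size q)%N by [].
by apply: IH; rewrite !size_drop ?qr //; move: qn iq; rewrite ?qr; lia.
Qed.

Lemma F_nil x : F_qr [::] [::] x = 1 :> C.
Proof. by []. Qed.

(** In [F_rec], cutting off the whole index leaves the constant f(0), which completes the difference
    handled by [f_step]. The other cuts keep the last entry inside the shorter F, where induction
    applies; under the integral the terms recombine by [F_rec] for [q] and [r]. *)
Lemma F_step q r a b t : size q = size r -> 0 <= t -> t <= 2 * pi ->
  F_qr (rcons q a) (rcons r b) t =
  cint t (fun x => 'i * ix x ^+ a * Lam x ^+ b * F_qr q r x).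
Proof.
move=> + t0 t2; have [n] := ubnP (size q); elim: n q r => // n IH q r; rewrite ltnS => qn qr.
have tq : take (size r).+1 (rcons q a) = rcons q a by rewrite -qr -(size_rcons q a) take_size.
have dq : drop (size r).+1 (rcons q a) = [::] by rewrite -qr -(size_rcons q a) drop_size.
have tr : take (size r).+1 (rcons r b) = rcons r b by rewrite -(size_rcons r b) take_size.
have dr : drop (size r).+1 (rcons r b) = [::] by rewrite -(size_rcons r b) drop_size.
rewrite F_rec ?size_rcons ?qr // big_ord_recr /= tq dq tr dr F_nil mulr1.
have lgd (i : nat) : lg (F_qr (drop i q) (drop i r) : R -> C).
  by apply: lg_F; rewrite !size_drop qr.
set S := \sum_(i < size r) _.
transitivity (f_qr (rcons q a) (rcons r b) t - f_qr (rcons q a) (rcons r b) 0 - S).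
  by ring.
rewrite f_step //.
transitivity (cint t (fun x => 'i * ix x ^+ a * Lam x ^+ b * f_qr q r x) +
  \sum_(i < size q) cint t (fun x => (- f_qr (take i.+1 q) (take i.+1 r) 0) *
    ('i * ix x ^+ a * Lam x ^+ b * F_qr (drop i.+1 q) (drop i.+1 r) x))).
  congr (_ + _); rewrite /S -sumrN qr; apply: eq_bigr => i _.
  have ir : (i < size r)%N by [].
  have iq : (i < size q)%N by rewrite qr.
  rewrite cintZ //; last first.
    by apply: lg_kernel; exact: lgd.
  rewrite -IH ?size_drop ?qr //; last by move: qn ir; rewrite qr; lia.
  have tE (s : seq nat) e : (i < size s)%N -> take i.+1 (rcons s e) = take i.+1 s.
    by move=> h; rewrite -cats1 takel_cat.
  have dE (s : seq nat) e : (i < size s)%N -> drop i.+1 (rcons s e) = rcons (drop i.+1 s) e.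
    by move=> h; rewrite drop_rcons.
  by rewrite mulNr !tE // !dE.
rewrite -cint_sum //; last first.
  move=> i _; apply: lgM; first exact: lg_cst.
  by apply: lg_kernel; exact: lgd.
rewrite -cintD //; last 2 first.
- by apply: lg_kernel; exact: lg_f.
- apply: lg_sum => i _; apply: lgM; first exact: lg_cst.
  by apply: lg_kernel; exact: lgd.
apply: eq_cint => // x _; rewrite [in RHS]F_rec // mulrBr; congr (_ + _).
rewrite mulr_sumr -sumrN; apply: eq_bigr => i _; ring.
Qed.

End Recursion.

(** * Iterated log-sine integrals *)

Section LogSineIntegral.
Variable R : realType.
Notation C := R[i].
Notation circ := (@circ R).
Implicit Types (x : R) (k l d : seq nat).

Lemma Afun_Lam x : (Afun x)%:C = - (Lam x + (- 'i * pi%:C) / 2 + ix x / 2) :> C.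
Proof.
have two z : z / 2 = (2^-1 : R)%:C * z :> C by rewrite mulrC fmorphV rmorph_nat.
rewrite !two /ix /Lam; apply: complex_eq;
  rewrite !(cReN, cImN, cReD, cImD, cReM, cImM) /=; by field.
Qed.

Lemma real_ix x : x%:C = - 'i * ix x :> C.
Proof. by rewrite /ix; apply: complex_eq; rewrite !(cReM, cImM, cReN, cImN) /=; ring. Qed.

Definition pqs (m : nat) : seq (nat * nat) :=
  [seq (p, q) | p <- iota 0 m.+1, q <- iota 0 (m.+1 - p)%N].

Lemma big_triples_cons (V : nmodType) (phi : seq nat * seq nat * seq nat -> V) e d :
  \sum_(t <- triples (e :: d)) phi t = \sum_(pq <- pqs e) \sum_(t <- triples d)
    phi (pq.1 :: t.1.1, pq.2 :: t.1.2, (e - pq.1 - pq.2)%N :: t.2).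
Proof.
rewrite -[triples _]/(flatten [seq [seq (pq.1 :: t.1.1, pq.2 :: t.1.2,
  (e - pq.1 - pq.2)%N :: t.2) | t <- triples d] | pq <- pqs e]).
by rewrite big_flatten big_map; apply: eq_bigr => pq _; rewrite big_map.
Qed.

(** [triples] recurses on the first entry, while the outermost integration variable is the last
    one. *)
Lemma big_triples_rcons (V : nmodType) (phi : seq nat * seq nat * seq nat -> V) d m :
  \sum_(t <- triples (rcons d m)) phi t =
  \sum_(t <- triples d) \sum_(pq <- pqs m)
    phi (rcons t.1.1 pq.1, rcons t.1.2 pq.2, rcons t.2 (m - pq.1 - pq.2)%N).
Proof.
elim: d phi => [|e d IH] phi.
  by rewrite big_triples_cons big_seq1; apply: eq_bigr => pq _; rewrite big_seq1.
by rewrite rcons_cons !big_triples_cons; apply: eq_bigr => pq _; rewrite IH.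
Qed.

Lemma size_triples d t : t \in triples d ->
  [/\ size t.1.1 = size d, size t.1.2 = size d & size t.2 = size d].
Proof.
elim: d t => [|e d IH] t; first by rewrite inE => /eqP ->.
move=> /flattenP[s /mapP[pq _ ->] /mapP[t' /IH[h1 h2 h3] ->]] /=.
by rewrite h1 h2 h3.
Qed.

(** Two nested binomial expansions. The exponents p, q and the remaining one belong to the constant,
    to ix/2 and to [Lam] respectively. *)
Lemma trinomial (a b c : C) m :
  (a + b + c) ^+ m = \sum_(pq <- pqs m)
    (m`!%:R / (pq.1`!%:R * pq.2`!%:R * (m - pq.1 - pq.2)`!%:R)) *
    (b ^+ pq.1 * c ^+ pq.2 * a ^+ (m - pq.1 - pq.2)).
Proof.
have f0 n : n`!%:R != 0 :> C by rewrite pnatr_eq0 -lt0n fact_gt0.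
rewrite big_allpairs_dep -addrA [b + c]addrC addrA exprDn.
rewrite -[iota 0 m.+1]/(index_iota 0 m.+1) big_mkord; apply: eq_bigr => p _.
have pm : (p <= m)%N by rewrite -ltnS.
rewrite subSn // -[iota 0 _]/(index_iota 0 (m - p).+1) big_mkord exprDn.
rewrite mulr_suml -sumrMnl; apply: eq_bigr => q _ /=.
have qm : (q <= m - p)%N by rewrite -ltnS.
rewrite -[LHS]mulr_natr -[_ *+ 'C(_, q)]mulr_natr.
have -> : m`!%:R = 'C(m, p)%:R * ('C(m - p, q)%:R * (p`!%:R * q`!%:R * (m - p - q)`!%:R)) :> C.
  rewrite -(bin_fact pm) -(bin_fact qm) !natrM; ring.
move: (f0 p) (f0 q) (f0 (m - p - q)%N).
move: (p`!%:R : C) (q`!%:R : C) ((m - p - q)`!%:R : C) => A B D A0 B0 D0.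
by field; rewrite A0 B0 D0.
Qed.

Lemma multinom3_rcons d p q r m a b c :
  multinom3 (rcons d m) (rcons p a) (rcons q b) (rcons r c) =
  multinom3 d p q r * (m`!%:R / (a`!%:R * b`!%:R * c`!%:R)) :> C.
Proof.
rewrite /multinom3 -!cats1 !big_cat !big_seq1 /= !invfM; ring.
Qed.

Definition coef d (t : seq nat * seq nat * seq nat) : C :=
  (- 'i * pi%:C) ^+ (sumn t.1.1) / (2 ^+ (sumn t.1.1 + sumn t.1.2)) *
  multinom3 d t.1.1 t.1.2 t.2.

Lemma coef_rcons d t m a b c :
  coef (rcons d m) (rcons t.1.1 a, rcons t.1.2 b, rcons t.2 c) =
  coef d t * ((m`!%:R / (a`!%:R * b`!%:R * c`!%:R)) *
    (((- 'i * pi%:C) / 2) ^+ a * 2^-1 ^+ b)).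
Proof.
rewrite /coef /= multinom3_rcons !sumn_rcons !exprD !exprMn !invfM !exprVn; ring.
Qed.

Definition Gsum k l x : C := \sum_(t <- triples (idx_km1l k l))
  coef (idx_km1l k l) t * F_qr (idx_add t.1.2 l) t.2 x.

Lemma size_idx_km1l k l : size k = size l -> size (idx_km1l k l) = size l.
Proof. by move=> kl; rewrite size_map size_zip kl minnn. Qed.

Lemma size_idx_add k l : size k = size l -> size (idx_add k l) = size l.
Proof. by move=> kl; rewrite size_map size_zip kl minnn. Qed.

Lemma idx_km1l_rcons k l a b : size k = size l ->
  idx_km1l (rcons k a) (rcons l b) = rcons (idx_km1l k l) (a - 1 - b)%N.
Proof. by move=> kl; rewrite /idx_km1l zip_rcons // map_rcons. Qed.

Lemma idx_add_rcons k l a b : size k = size l ->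
  idx_add (rcons k a) (rcons l b) = rcons (idx_add k l) (a + b)%N.
Proof. by move=> kl; rewrite /idx_add zip_rcons // map_rcons. Qed.

Lemma triples_sizes k l t : size k = size l -> t \in triples (idx_km1l k l) ->
  size t.1.2 = size l /\ size t.2 = size l.
Proof. by move=> kl /size_triples[_ -> ->]; rewrite size_idx_km1l. Qed.

Lemma lg_Gsum k l : size k = size l -> lg (Gsum k l).
Proof.
move=> kl; apply: lg_sum => t /(triples_sizes kl)[h1 h2].
apply: lgM; first exact: lg_cst.
by apply: lg_F; rewrite size_idx_add // h1 h2.
Qed.

(** Expanding (-A)^m by [trinomial] raises the power of ix from b to q + b and produces Lam^r;
    [F_step] then integrates each term. This is why F carries the index q + l. *)
Lemma Gsum_step k l a b (t : R) : size k = size l -> 0 <= t -> t <= 2 * pi ->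
  Gsum (rcons k a) (rcons l b) t =
  cint t (fun x => 'i * ix x ^+ b * (- (Afun x)%:C) ^+ (a - 1 - b) * Gsum k l x).
Proof.
move=> kl t0 t2; rewrite /Gsum idx_km1l_rcons // big_triples_rcons.
set d := idx_km1l k l; set m := (a - 1 - b)%N.
pose w (pq : nat * nat) : C := (m`!%:R / (pq.1`!%:R * pq.2`!%:R * (m - pq.1 - pq.2)`!%:R)) *
  (((- 'i * pi%:C) / 2) ^+ pq.1 * 2^-1 ^+ pq.2).
pose F' (t : seq nat * seq nat * seq nat) : R -> C := F_qr (idx_add t.1.2 l) t.2.
have lF t' : t' \in triples d -> lg (F' t').
  move=> /(triples_sizes kl)[h1 h2].
  by apply: lg_F; rewrite size_idx_add // h1 h2.
transitivity (\sum_(t' <- triples d) \sum_(pq <- pqs m) cint t (fun x =>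
   coef d t' * w pq * ('i * ix x ^+ (pq.2 + b) * Lam x ^+ (m - pq.1 - pq.2) * F' t' x))).
  apply: eq_big_seq => t' t'd; apply: eq_bigr => pq _.
  have [h1 h2] := triples_sizes kl t'd.
  rewrite cintZ //; last by apply: lg_kernel; exact: lF.
  rewrite coef_rcons /= idx_add_rcons // F_step ?size_idx_add ?h1 ?h2 //.
have lk t' pq : t' \in triples d -> lg (fun x =>
   coef d t' * w pq * ('i * ix x ^+ (pq.2 + b) * Lam x ^+ (m - pq.1 - pq.2) * F' t' x)).
  by move=> /lF h; apply: lgM; [exact: lg_cst | exact: lg_kernel].
transitivity (\sum_(t' <- triples d) cint t (fun x => \sum_(pq <- pqs m)
   coef d t' * w pq * ('i * ix x ^+ (pq.2 + b) * Lam x ^+ (m - pq.1 - pq.2) * F' t' x))).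
  by apply: eq_big_seq => t' t'd; rewrite cint_sum // => pq _; exact: lk.
rewrite -cint_sum //; last by move=> t' t'd; apply: lg_sum => pq _; exact: lk.
apply: eq_cint => // x _; rewrite Afun_Lam opprK trinomial mulr_sumr.
apply: eq_bigr => t' _; rewrite mulr_sumr mulr_suml; apply: eq_bigr => pq _.
rewrite /w /F' exprD [(ix x / 2) ^+ _]exprMn; ring.
Qed.

(** The endpoints of the closed interval in [Irec] are null sets; for t <= 0 both integrals
    vanish. *)
Lemma cint_real (f : R -> R) (t : R) : t <= 2 * pi -> lg (fun x => (f x)%:C) ->
  cint t (fun x => (f x)%:C) = (\int[@lebesgue_measure R]_(x in `[0, t]) f x)%:C.
Proof.
move=> t2 fl; have [/= i1 _] := lg_integrable t2 fl.
have m1 := measurable_int _ i1.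
apply: complex_eq => /=; last by rewrite Rintegral_cst // mul0r.
have [t0|t0] := ltP 0 t; last first.
  rewrite [in LHS]set_itv_ge ?bnd_simp -?leNgt // Rintegral_set0.
  move: t0; rewrite le_eqVlt => /predU1P[->|t0].
    by rewrite set_itv1 Rintegral_set1.
  by rewrite set_itv_ge ?bnd_simp -?ltNge // Rintegral_set0.
rewrite /Rintegral integral_itv_obnd_cbnd // integral_itv_bndo_bndc //.
have -> : `[0, t[%classic = [set 0] `|` `]0, t[%classic :> set R.
  by rewrite setU1itv // bnd_simp.
apply/measurable_funU => //; split => //.
exact: measurable_fun_set1.
Qed.

(** Each variable contributes (-1)^m from passing from A^m to (-A)^m, (-i)^b from theta^b = (-i)^b
    (i theta)^b, and one more -i from d theta = -i d(i theta). *)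
Lemma Irec_Gsum k l (t : R) : size k = size l -> 0 <= t -> t <= 2 * pi ->
  (Irec (rev (zip k l)) t)%:C =
  (-1) ^+ sumn (idx_km1l k l) * (- 'i) ^+ (sumn l + size l) * Gsum k l t.
Proof.
elim/last_ind: l k t => [|l b IH] k t; case/lastP: k => [|k a]; rewrite ?size_rcons //.
  by rewrite /= /Gsum big_seq1 /= /coef /multinom3 /= !big_nil !expr0 F_nil !mul1r invr1 !mulr1.
case=> kl t0 t2; rewrite zip_rcons // rev_rcons /= Gsum_step //.
set m := (a - 1 - b)%N; set c := (-1) ^+ _ * _ : C.
pose f x := x ^+ b * Afun x ^+ m * Irec (rev (zip k l)) x.
have fE x : circ x -> (f x)%:C = c * ('i * ix x ^+ b * (- (Afun x)%:C) ^+ m * Gsum k l x).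
  move=> /circP /andP[x0 x2]; rewrite /f !rmorphM !rmorphXn /= IH ?(ltW x0) ?(ltW x2) //.
  rewrite {1}real_ix /c idx_km1l_rcons // !sumn_rcons -/m.
  rewrite addnS exprS !exprD [(- 'i * ix x) ^+ b]exprMn.
  rewrite [(- (Afun x)%:C) ^+ m]exprNn.
  have i2 : - 'i * 'i = 1 :> C by rewrite mulNr -expr2 sqr_i opprK.
  have s2 : (-1) ^+ m * (-1) ^+ m = 1 :> C by rewrite -exprMn mulrNN mulr1 expr1n.
  (* Two factors equal to 1 are inserted to match the squared sign and the product of -i with the i
     of the kernel. *)
  transitivity (((-1) ^+ m * (-1) ^+ m) * (- 'i * 'i) *
    ((- 'i) ^+ b * ix x ^+ b * ((Afun x)%:C ^+ m) * ((-1) ^+ sumn (idx_km1l k l) *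
    ((- 'i) ^+ sumn l * (- 'i) ^+ size l) * Gsum k l x))); last first.
    move: (Gsum k l x) (ix x ^+ b) ((Afun x)%:C ^+ m) => g1 g2 g3.
    by ring.
  by rewrite i2 s2 !mul1r.
have lk : lg (fun x => 'i * ix x ^+ b * (- (Afun x)%:C) ^+ m * Gsum k l x).
  apply: lgM; last exact: lg_Gsum.
  apply: lgM; first exact: lg_ixM.
  apply: lgX; apply: (@eq_lg _ (fun x => Lam x + (- 'i * pi%:C) / 2 + ix x / 2)).
    by move=> x _; rewrite Afun_Lam opprK.
  apply: lgD; last by apply: lgM; [exact: lg_ix | exact: lg_cst].
  by apply: lgD; [exact: lg_Lam | exact: lg_cst].
rewrite -cintZ //.
have lf : lg (fun x => (f x)%:C).
  apply: (@eq_lg _ (fun x => c * ('i * ix x ^+ b * (- (Afun x)%:C) ^+ m * Gsum k l x))).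
    by move=> x cx; rewrite fE.
  by apply: lgM; [exact: lg_cst | exact: lk].
rewrite -[LHS](cint_real t2 lf).
exact: eq_cint.
Qed.

End LogSineIntegral.

Theorem theorem1 (R : realType) (n : nat) (k l : seq nat) (sigma : R) :
  size k = n -> size l = n ->
  (forall u, (u < n)%N -> (0 < nth 0 k u)%N) ->
  (forall u, (u < n)%N -> (nth 0 l u + 1 <= nth 0 k u)%N) ->
  0 <= sigma -> sigma <= 2 * pi ->
  (Ls k l sigma)%:C =
    'i ^+ (sumn l + n) * (-1) ^+ (sumn k + n) *
    \sum_(t <- triples (idx_km1l k l))
      ((- 'i * pi%:C) ^+ (sumn t.1.1) / (2 ^+ (sumn t.1.1 + sumn t.1.2))
       * multinom3 (idx_km1l k l) t.1.1 t.1.2 t.2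
       * F_qr (idx_add t.1.2 l) t.2 sigma).
Proof.
move=> kn ln _ kl s0 s2; have szkl : size k = size l by rewrite kn ln.
rewrite -/(coef _ _ _) -/(Gsum k l sigma).
(* The truncated subtractions in [idx_km1l] are exact since l_u + 1 <= k_u, which yields the parity
   relating the two sign conventions. *)
have sk : sumn k = (sumn (idx_km1l k l) + sumn l + n)%N.
  move: kl; rewrite -ln; elim: l k szkl {kn ln} => [|b l IH] [|a k] //= [sz] kl.
  have := kl 0%N isT; rewrite /= => h0.
  rewrite (IH k sz) => [|u hu]; last exact: (kl u.+1 hu).
  by rewrite /idx_km1l; lia.
rewrite /Ls rmorphM rmorphXn rmorphN rmorph1 /= Irec_Gsum // ln kn mulrA; congr (_ * _).
rewrite sk [(- 'i) ^+ _]exprNn !exprD.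
ring.
Qed.
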